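(* For complex parameters $a,b,c,e,f$ the following identity holds: $$ \begin{aligned} {}_{4}F_3\!\left(\begin{matrix}a,b,c,f+1\\ b+1,e,f\end{matrix}\right) ={}&\frac{abc(b-f)}{f(b-a)(b-c)}\left\{{}_{2}\hat{F}_1\!\left(\left.\begin{matrix}a,c\\ e\end{matrix}\right\vert b\right)+\frac{1+a+c-e}{e}\,{}_{2}\hat{F}_1\!\left(\left.\begin{matrix}a+1,c+1\\ e+1\end{matrix}\right\vert b+1\right)\right\}\\ &+\frac{f(b-c)\big(a^2+(a-b)(c-e+1)\big)+ab^2(c-f)}{f(b-a)(b-c)}\,\frac{\Gamma(e)\Gamma(e-a-c-1)}{\Gamma(e-a)\Gamma(e-c)}. \end{aligned} $$
   Context: Notation: $(x)_0=1$, $(x)_n=x(x+1)\cdots(x+n-1)$ is the rising factorial, $\psi=\Gamma'/\Gamma$ is the logarithmic derivative of the gamma function, and the hypergeometric function is evaluated at unit argument, which is omitted from the notation: $$ {}_4F_3\!\left(\begin{array}{c} a_1,a_2,a_3,a_4\\ b_1,b_2,b_3\end{array}\right)=\sum_{n=0}^\infty \frac{(a_1)_n(a_2)_n(a_3)_n(a_4)_n}{(b_1)_n(b_2)_n(b_3)_n\,n!} $$ (no lower parameter is a non-positive integer). The function ${}_2\hat F_1$ is defined by $$ {}_{2}\hat{F}_1\!\left(\left.\begin{matrix}a,c\\ e\end{matrix}\right\vert b\right):=\sum_{k=1}^{\infty}\frac{(a)_k(c)_{k}}{(e)_k\,k!}\big(\psi(b+k)-\psi(b)\big). $$ Standing convention: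 the parameters are assumed to be chosen so that all infinite series in the statement converge and the rational and gamma functions appearing in the formulas do not become infinite (all denominators are nonzero). *)

(* Defs.v *)
From Stdlib Require Export Reals Factorial.
From Coquelicot Require Export Coquelicot.

Local Open Scope C_scope.

Definition CLim_seq (u : nat -> C) : C :=
  (real (Lim_seq (fun n => Re (u n))), real (Lim_seq (fun n => Im (u n)))).

Definition CSeries (u : nat -> C) : C :=
  (Series (fun n => Re (u n)), Series (fun n => Im (u n))).

Definition Cex_series (u : nat -> C) : Prop :=
  @ex_series C_AbsRing C_NormedModule u.

Fixpoint poch (x : C) (n : nat) : C :=
  match n with
  | O => 1
  | S m => poch x m * (x + INR m)
  end.

Definition nonpos_int (z : C) : Prop := exists n : nat, z = - INR n.

(* t ^ z = exp (z ln t), meaningful for t > 0. *)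
Definition RCpower (t : R) (z : C) : C :=
  RtoC (exp (Re z * ln t)) * (cos (Im z * ln t), sin (Im z * ln t)).

(* Euler's limit n! n^z / (z (z+1) ... (z+n)), valid for every complex z
   that is not a non-positive integer. *)
Definition Gamma (z : C) : C :=
  CLim_seq (fun n => INR (fact n) * RCpower (INR n) z / poch z (S n)).

Definition digamma (z : C) : C := C_derive Gamma z / Gamma z.

Definition hyp4F3_term (a1 a2 a3 a4 b1 b2 b3 : C) (n : nat) : C :=
  poch a1 n * poch a2 n * poch a3 n * poch a4 n
  / (poch b1 n * poch b2 n * poch b3 n * INR (fact n)).

Definition hyp4F3 (a1 a2 a3 a4 b1 b2 b3 : C) : C :=
  CSeries (hyp4F3_term a1 a2 a3 a4 b1 b2 b3).

Definition hat2F1_term (a c e b : C) (k : nat) : C :=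
  poch a k * poch c k / (poch e k * INR (fact k))
  * (digamma (b + INR k) - digamma b).

(* The summation index k starts at 1. *)
Definition hat2F1_summand (a c e b : C) (n : nat) : C :=
  hat2F1_term a c e b (S n).

Definition hat2F1 (a c e b : C) : C := CSeries (hat2F1_summand a c e b).

(* Main.v *)
From Stdlib Require Import Lra Lia.
Require Import Defs.
Local Open Scope C_scope.

(** Let t n = (a)_n (c)_n / ((e)_n n!), let H n be the sum of 1 / (b + j) for
    j < n, and put s = 1 + a + c - e.  Because the parameters b, b + 1 and
    f + 1, f differ by 1, the 4F3 series is a combination of F = sum t n and
    S = sum t n / (b + n).  Because psi (b + n) - psi b = H n
    ([digamma_plus_INR]), the two logarithmic series are sums of t n H n and,
    up to the factor a c / e, of n t n (H n - 1 / b).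

    These sums are linked by summation by parts.  The sequence
    u n = n (n + e - 1) t n satisfies u (n + 1) = (n + a) (n + c) t n, so its
    increments are t n (a c + s n).  Summing (u (n + 1) - u n) H n by parts
    replaces H n by 1 / (b + n) and leaves
    sum t n (n + a) (n + c) / (b + n); division of the quadratic by b + n
    produces S with coefficient (a - b) (c - b), plus multiples of sum n t n and
    sum t n.  Summing the increments of u themselves gives
    sum n t n = - (a c / s) F.  This is [harmonic_sum_relation].  Gauss's theorem
    ([gauss_summation]) evaluates F, and the identity is then rational algebra.

    Three points need analysis.

    The boundary terms u n and u n H n must vanish at infinity, although only
    convergence of the three series is assumed.  [boundary_limits] derives this
    from the divergence of H n and of the harmonic series, without a case
    distinction on the real parts of the parameters or on terminating series.

    Gauss's theorem follows from the contiguous relation between e and e + 1: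
    iterated, it expresses F as a quotient of rising factorials, which tends to
    the quotient of Gamma values by Euler's limit, times a sum that tends to 1
    as its lower parameter grows.

    The function psi is defined through a derivative of Euler's limit.
    Euler's product and its ratio at z + h and z have factors that are
    1 + O(1 / n^2), and 1 + h d n + O(h^2 / n^2) respectively, uniformly in h.
    This yields existence and nonvanishing of Gamma, its differentiability, and
    psi z = lim (ln n - 1 / z - ... - 1 / (z + n)) ([digamma_limit]), hence
    psi (z + 1) = psi z + 1 / z. *)

(** * Complex moduli *)

Lemma Cmod_minus_le (x y : C) : (Cmod (x - y) <= Cmod x + Cmod y)%R.
Proof.
  unfold Cminus. rewrite <- (Cmod_opp y). apply Cmod_triangle.
Qed.

Lemma Cmod_plus_ge (x y : C) : (Cmod x - Cmod y <= Cmod (x + y))%R.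
Proof.
  pose proof (Cmod_minus_le (x + y) y) as H.
  replace (x + y - y) with x in H by ring. lra.
Qed.

Lemma Cmod_le_Re_Im (z : C) : (Cmod z <= Rabs (Re z) + Rabs (Im z))%R.
Proof.
  destruct z as [x y]. simpl.
  replace (x, y) with (RtoC x + Ci * RtoC y).
  - eapply Rle_trans; [apply Cmod_triangle|].
    rewrite Cmod_mult, !Cmod_R, Cmod_Ci. lra.
  - unfold RtoC, Ci, Cplus, Cmult; simpl. f_equal; ring.
Qed.

Lemma Im_le_Cmod (z : C) : (Rabs (Im z) <= Cmod z)%R.
Proof.
  eapply Rle_trans; [|apply Rmax_Cmod]. apply Rmax_r.
Qed.

Lemma RtoC_neq_0 (x : R) : x <> 0%R -> RtoC x <> 0.
Proof. intros H E. apply H. now apply RtoC_inj. Qed.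

Lemma INR_S_pos (n : nat) : (0 < INR (S n))%R.
Proof. apply lt_0_INR. lia. Qed.

Lemma Cdiv_neq_0 (x y : C) : x <> 0 -> y <> 0 -> x / y <> 0.
Proof.
  intros Hx Hy E. apply Hx. replace x with (x / y * y) by (field; exact Hy).
  rewrite E. ring.
Qed.

Lemma RtoC_S (n : nat) : RtoC (INR (S n)) = INR n + 1.
Proof. rewrite S_INR, RtoC_plus. reflexivity. Qed.

Lemma RtoC_S_neq_0 (n : nat) : RtoC (INR (S n)) <> 0.
Proof. apply RtoC_neq_0. pose proof (INR_S_pos n). lra. Qed.

Lemma fact_neq_0_C (n : nat) : RtoC (INR (fact n)) <> 0.
Proof. apply RtoC_neq_0, INR_fact_neq_0. Qed.

(** * Limits and series of complex numbers *)

(** Convergence of both coordinates, so that limit theorems for real sequences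
    apply directly and [CLim_seq] returns the limit. *)
Definition Clim (u : nat -> C) (l : C) : Prop :=
  is_lim_seq (fun n => Re (u n)) (Re l) /\
  is_lim_seq (fun n => Im (u n)) (Im l).

Lemma Clim_ext (u v : nat -> C) (l : C) :
  (forall n, u n = v n) -> Clim u l -> Clim v l.
Proof.
  intros E [H1 H2]; split; (eapply is_lim_seq_ext; [|eassumption]);
    intros n; simpl; now rewrite E.
Qed.

Lemma Clim_const (l : C) : Clim (fun _ => l) l.
Proof. split; apply is_lim_seq_const. Qed.

Lemma Clim_plus (u v : nat -> C) (l m : C) :
  Clim u l -> Clim v m -> Clim (fun n => u n + v n) (l + m).
Proof. intros [H1 H2] [H3 H4]; split; simpl; now apply is_lim_seq_plus'. Qed.

Lemma Clim_minus (u v : nat -> C) (l m : C) :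
  Clim u l -> Clim v m -> Clim (fun n => u n - v n) (l - m).
Proof. intros [H1 H2] [H3 H4]; split; simpl; now apply is_lim_seq_minus'. Qed.

Lemma Clim_mult (u v : nat -> C) (l m : C) :
  Clim u l -> Clim v m -> Clim (fun n => u n * v n) (l * m).
Proof.
  intros [H1 H2] [H3 H4]; split; simpl.
  - apply is_lim_seq_minus'; now apply is_lim_seq_mult'.
  - apply is_lim_seq_plus'; now apply is_lim_seq_mult'.
Qed.

Lemma Clim_Cmod_0 (u : nat -> C) (l : C) :
  is_lim_seq (fun n => Cmod (u n - l)) 0 -> Clim u l.
Proof.
  assert (G : forall (r : nat -> R) (x : R) (m : nat -> R),
    (forall n, (Rabs (r n - x) <= m n)%R) -> is_lim_seq m 0 -> is_lim_seq r x).
  { intros r x m Hb Hm.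
    apply is_lim_seq_le_le with (u := fun n => (x - m n)%R) (w := fun n => (x + m n)%R).
    - intros n. specialize (Hb n). apply Rabs_le_between in Hb. lra.
    - replace (Finite x) with (Finite (x - 0)) by (f_equal; ring).
      apply is_lim_seq_minus'; [apply is_lim_seq_const|exact Hm].
    - replace (Finite x) with (Finite (x + 0)) by (f_equal; ring).
      apply is_lim_seq_plus'; [apply is_lim_seq_const|exact Hm]. }
  intros H; split; (eapply G; [|exact H]); intros n; simpl.
  - exact (re_le_Cmod (u n - l)).
  - exact (Im_le_Cmod (u n - l)).
Qed.

Lemma Clim_Cmod_minus (u : nat -> C) (l : C) :
  Clim u l -> is_lim_seq (fun n => Cmod (u n - l)) 0.
Proof.
  intros H. destruct (Clim_minus _ _ _ _ H (Clim_const l)) as [H1 H2].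
  replace (l - l) with (RtoC 0) in H1, H2 by ring. simpl in H1, H2.
  apply is_lim_seq_abs_0 in H1. apply is_lim_seq_abs_0 in H2.
  apply is_lim_seq_le_le with (u := fun _ => 0%R)
    (w := fun n => (Rabs (Re (u n - l)) + Rabs (Im (u n - l)))%R).
  - intros n. split; [apply Cmod_ge_0|apply Cmod_le_Re_Im].
  - apply is_lim_seq_const.
  - replace (Finite 0) with (Finite (0 + 0)) by (f_equal; ring).
    now apply is_lim_seq_plus'.
Qed.

Lemma Clim_Cmod (u : nat -> C) (l : C) :
  Clim u l -> is_lim_seq (fun n => Cmod (u n)) (Cmod l).
Proof.
  intros H. apply Clim_Cmod_minus in H.
  apply is_lim_seq_le_le with (u := fun n => (Cmod l - Cmod (u n - l))%R)
    (w := fun n => (Cmod l + Cmod (u n - l))%R).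
  - intros n. split.
    + pose proof (Cmod_minus_le (u n) (u n - l)) as E.
      replace (u n - (u n - l)) with l in E by ring. lra.
    + pose proof (Cmod_triangle l (u n - l)) as E.
      replace (l + (u n - l)) with (u n) in E by ring. lra.
  - replace (Finite (Cmod l)) with (Finite (Cmod l - 0)) by (f_equal; ring).
    apply is_lim_seq_minus'; [apply is_lim_seq_const|exact H].
  - replace (Finite (Cmod l)) with (Finite (Cmod l + 0)) by (f_equal; ring).
    apply is_lim_seq_plus'; [apply is_lim_seq_const|exact H].
Qed.

Lemma Clim_squeeze_0 (u : nat -> C) (m : nat -> R) :
  eventually (fun n => (Cmod (u n) <= m n)%R) -> is_lim_seq m 0 -> Clim u 0.
Proof.
  intros [N H] Hm. apply Clim_Cmod_0.
  apply is_lim_seq_le_le_loc with (u := fun _ => 0%R) (w := m).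
  - exists N. intros n Hn. split; [apply Cmod_ge_0|].
    replace (u n - 0) with (u n) by ring. now apply H.
  - apply is_lim_seq_const.
  - exact Hm.
Qed.

Lemma Clim_Cmod_le (u : nat -> C) (l : C) (K : R) :
  (forall n, (Cmod (u n) <= K)%R) -> Clim u l -> (Cmod l <= K)%R.
Proof.
  intros H Hl. apply Clim_Cmod in Hl.
  exact (is_lim_seq_le _ _ (Cmod l) K H Hl (is_lim_seq_const K)).
Qed.

Lemma Clim_bounded (u : nat -> C) (l : C) :
  Clim u l -> exists K : R, forall n, (Cmod (u n) <= K)%R.
Proof.
  intros H. apply Clim_Cmod in H.
  destruct (@filterlim_bounded R_AbsRing R_NormedModule (fun n => Cmod (u n))
              (ex_intro _ (Cmod l) H)) as [K HK].
  exists K. intros n. eapply Rle_trans; [apply Rle_abs|]. apply HK.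
Qed.

Lemma Clim_CLim_seq (u : nat -> C) (l : C) : Clim u l -> CLim_seq u = l.
Proof.
  intros [H1 H2]. unfold CLim_seq.
  rewrite (is_lim_seq_unique _ _ H1), (is_lim_seq_unique _ _ H2).
  now destruct l.
Qed.

Lemma Clim_unique (u : nat -> C) (l m : C) : Clim u l -> Clim u m -> l = m.
Proof. intros H1 H2. rewrite <- (Clim_CLim_seq _ _ H1). now apply Clim_CLim_seq. Qed.

Lemma Clim_incr (u : nat -> C) (l : C) : Clim u l -> Clim (fun n => u (S n)) l.
Proof.
  intros [H1 H2]; split.
  - exact (proj1 (is_lim_seq_incr_1 (fun n => Re (u n)) (Re l)) H1).
  - exact (proj1 (is_lim_seq_incr_1 (fun n => Im (u n)) (Im l)) H2).
Qed.

Lemma Clim_decr (u : nat -> C) (l : C) : Clim (fun n => u (S n)) l -> Clim u l.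
Proof.
  intros [H1 H2]; split.
  - exact (proj2 (is_lim_seq_incr_1 (fun n => Re (u n)) (Re l)) H1).
  - exact (proj2 (is_lim_seq_incr_1 (fun n => Im (u n)) (Im l)) H2).
Qed.

Lemma Clim_ext_loc (u v : nat -> C) (l : C) :
  eventually (fun n => u n = v n) -> Clim u l -> Clim v l.
Proof.
  intros [N E] [H1 H2]; split; (eapply is_lim_seq_ext_loc; [|eassumption]);
    exists N; intros n Hn; now rewrite (E n Hn).
Qed.

Lemma Clim_inv (u : nat -> C) (l : C) :
  l <> 0 -> Clim u l -> Clim (fun n => / u n) (/ l).
Proof.
  intros Hl [H1 H2].
  assert (D : (Re l ^ 2 + Im l ^ 2 <> 0)%R).
  { rewrite <- Cmod2_alt. apply pow_nonzero.
    apply Cmod_gt_0 in Hl. lra. }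
  assert (HD : is_lim_seq (fun n => (Re (u n) ^ 2 + Im (u n) ^ 2)%R)
                          (Re l ^ 2 + Im l ^ 2)%R).
  { apply is_lim_seq_plus'; simpl; repeat apply is_lim_seq_mult'; auto;
      apply is_lim_seq_const. }
  split; simpl; unfold Rdiv.
  - apply is_lim_seq_mult'; [exact H1|].
    exact (is_lim_seq_inv _ (Finite _) HD (fun E => D (f_equal real E))).
  - apply is_lim_seq_mult'; [exact (proj1 (is_lim_seq_opp _ (Finite _)) H2)|].
    exact (is_lim_seq_inv _ (Finite _) HD (fun E => D (f_equal real E))).
Qed.

Lemma Clim_div (u v : nat -> C) (l m : C) :
  m <> 0 -> Clim u l -> Clim v m -> Clim (fun n => u n / v n) (l / m).
Proof. intros Hm H1 H2. apply Clim_mult; [exact H1|]. now apply Clim_inv. Qed.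

Lemma Clim_scal (k : C) (u : nat -> C) (l : C) :
  Clim u l -> Clim (fun n => k * u n) (k * l).
Proof. intros H. apply Clim_mult; [apply Clim_const|exact H]. Qed.

Fixpoint psum (u : nat -> C) (n : nat) : C :=
  match n with
  | O => 0
  | S m => psum u m + u m
  end.

(** The partial sums exclude the upper index, so that [psum u 0 = 0] and
    telescoping sums need no offset. *)
Definition Csum (u : nat -> C) (l : C) : Prop := Clim (psum u) l.

Lemma psum_ext (u v : nat -> C) (n : nat) :
  (forall k, u k = v k) -> psum u n = psum v n.
Proof. intros E. induction n; simpl; [reflexivity|]. now rewrite IHn, E. Qed.

Lemma psum_plus (u v : nat -> C) (n : nat) :
  psum (fun k => u k + v k) n = psum u n + psum v n.
Proof. induction n; simpl; [ring|]. rewrite IHn. ring. Qed.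

Lemma psum_scal (x : C) (u : nat -> C) (n : nat) :
  psum (fun k => x * u k) n = x * psum u n.
Proof. induction n; simpl; [ring|]. rewrite IHn. ring. Qed.

Lemma psum_telescope (u : nat -> C) (n : nat) :
  psum (fun k => u (S k) - u k) n = u n - u O.
Proof. induction n; simpl; [ring|]. rewrite IHn. ring. Qed.

Lemma psum_shift (u : nat -> C) (n : nat) :
  psum u (S n) = u O + psum (fun k => u (S k)) n.
Proof.
  induction n; [simpl; ring|].
  change (psum u (S (S n))) with (psum u (S n) + u (S n)). rewrite IHn.
  simpl. ring.
Qed.

Lemma Csum_ext (u v : nat -> C) (l : C) :
  (forall n, u n = v n) -> Csum u l -> Csum v l.
Proof. intros E. apply Clim_ext. intros n. now apply psum_ext. Qed.

Lemma Csum_plus (u v : nat -> C) (l m : C) :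
  Csum u l -> Csum v m -> Csum (fun n => u n + v n) (l + m).
Proof.
  intros H1 H2. eapply Clim_ext; [|exact (Clim_plus _ _ _ _ H1 H2)].
  intros n. now rewrite psum_plus.
Qed.

Lemma Csum_scal (x : C) (u : nat -> C) (l : C) :
  Csum u l -> Csum (fun n => x * u n) (x * l).
Proof.
  intros H. eapply Clim_ext; [|exact (Clim_scal x _ _ H)].
  intros n. now rewrite psum_scal.
Qed.

Lemma Csum_telescope (u : nat -> C) (l : C) :
  Clim u l -> Csum (fun n => u (S n) - u n) (l - u O).
Proof.
  intros H. eapply Clim_ext; [|exact (Clim_minus _ _ _ _ H (Clim_const (u O)))].
  intros n. now rewrite psum_telescope.
Qed.

Lemma Csum_telescope_inv (u : nat -> C) (l : C) :
  Csum (fun n => u (S n) - u n) l -> Clim u (l + u O).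
Proof.
  intros H. eapply Clim_ext; [|exact (Clim_plus _ _ _ _ H (Clim_const (u O)))].
  intros n. simpl. rewrite psum_telescope. ring.
Qed.

Lemma Csum_shift (u : nat -> C) (l : C) :
  Csum (fun n => u (S n)) l -> Csum u (u O + l).
Proof.
  intros H. apply Clim_decr.
  eapply Clim_ext; [|exact (Clim_plus _ _ _ _ (Clim_const (u O)) H)].
  intros n. now rewrite psum_shift.
Qed.

Lemma Csum_term_0 (u : nat -> C) (l : C) : Csum u l -> Clim u 0.
Proof.
  intros H. replace (RtoC 0) with (l - l) by ring.
  eapply Clim_ext; [|exact (Clim_minus _ _ _ _ (Clim_incr _ _ H) H)].
  intros n. simpl. ring.
Qed.

Lemma sum_n_psum (u : nat -> C) (n : nat) :
  @sum_n C_AbelianMonoid u n = psum u (S n).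
Proof.
  induction n.
  - rewrite sum_O. change (u O = 0 + u O). ring.
  - rewrite sum_Sn, IHn. reflexivity.
Qed.

Lemma sum_n_Re_Im (u : nat -> C) (n : nat) :
  sum_n (fun k => Re (u k)) n = Re (psum u (S n)) /\
  sum_n (fun k => Im (u k)) n = Im (psum u (S n)).
Proof.
  induction n.
  - rewrite !sum_O. simpl psum. now rewrite Cplus_0_l.
  - destruct IHn as [E1 E2]. rewrite !sum_Sn, E1, E2. split; reflexivity.
Qed.

Lemma Csum_CSeries (u : nat -> C) (l : C) : Csum u l -> CSeries u = l.
Proof.
  intros H. destruct (Clim_incr _ _ H) as [H1 H2]. unfold CSeries, Series.
  rewrite (is_lim_seq_unique _ (Finite (Re l))), (is_lim_seq_unique _ (Finite (Im l))).
  - now destruct l.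
  - eapply is_lim_seq_ext; [|exact H2]. intros n. symmetry. apply sum_n_Re_Im.
  - eapply is_lim_seq_ext; [|exact H1]. intros n. symmetry. apply sum_n_Re_Im.
Qed.

Lemma Cex_series_Csum (u : nat -> C) : Cex_series u -> Csum u (CSeries u).
Proof.
  intros [l Hl].
  assert (H : Csum u l).
  { apply Clim_decr. unfold is_series in Hl.
    split; unfold is_lim_seq.
    - apply filterlim_ext with (f := fun n => fst (sum_n u n)).
      { intros n. now rewrite sum_n_psum. }
      eapply filterlim_comp; [exact Hl|].
      intros P [eps HP]. exists eps. intros y [Hy _]. apply HP, Hy.
    - apply filterlim_ext with (f := fun n => snd (sum_n u n)).
      { intros n. now rewrite sum_n_psum. }
      eapply filterlim_comp; [exact Hl|].
      intros P [eps HP]. exists eps. intros y [_ Hy]. apply HP, Hy. }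
  now rewrite (Csum_CSeries _ _ H).
Qed.

(** * Products with factors 1 + O(1 / n^2) *)

(** A bounded sequence whose increments dominate 1 / (n + 1)^2: it replaces the
    value of the series of inverse squares in every estimate below. *)
Definition tau (n : nat) : R := (2 - 2 / INR (S n))%R.

Lemma tau_step (n : nat) : (/ INR (S n) ^ 2 <= tau (S n) - tau n)%R.
Proof.
  unfold tau. pose proof (INR_S_pos n) as H. rewrite (S_INR (S n)).
  assert (H1 : (1 <= INR (S n))%R) by (rewrite S_INR; pose proof (pos_INR n); lra).
  set (x := INR (S n)) in *.
  replace (2 - 2 / (x + 1) - (2 - 2 / x))%R with (/ x ^ 2 + (x - 1) / (x ^ 2 * (x + 1)))%R
    by (field; lra).
  assert (0 <= (x - 1) / (x ^ 2 * (x + 1)))%R; [|lra].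
  apply Rdiv_le_0_compat; [lra|]. apply Rmult_lt_0_compat; [apply pow_lt|]; lra.
Qed.

Lemma tau_O : tau 0 = 0%R.
Proof. unfold tau. simpl. field. Qed.

Lemma tau_le (n : nat) : (tau n <= 2)%R.
Proof.
  unfold tau. pose proof (INR_S_pos n).
  assert (0 < 2 / INR (S n))%R by (apply Rdiv_lt_0_compat; lra). lra.
Qed.

Lemma drift_bound (u : nat -> C) (K : R) :
  (0 <= K)%R ->
  (forall n, (Cmod (u (S n) - u n) <= K * / INR (S n) ^ 2)%R) ->
  forall n, (Cmod (u n - u O) <= 2 * K)%R.
Proof.
  intros HK H.
  assert (G : forall n, (Cmod (u n - u O) <= K * tau n)%R).
  { induction n.
    - replace (u O - u O) with (RtoC 0) by ring. rewrite Cmod_0, tau_O. lra.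
    - replace (u (S n) - u O) with ((u (S n) - u n) + (u n - u O)) by ring.
      eapply Rle_trans; [apply Cmod_triangle|].
      specialize (H n). pose proof (tau_step n).
      assert (K * / INR (S n) ^ 2 <= K * (tau (S n) - tau n))%R
        by (apply Rmult_le_compat_l; lra).
      lra. }
  intros n. specialize (G n). pose proof (tau_le n).
  assert (K * tau n <= K * 2)%R by (apply Rmult_le_compat_l; lra). lra.
Qed.

Lemma is_lim_seq_inv_INR_S : is_lim_seq (fun n => (/ INR (S n))%R) 0.
Proof.
  apply (is_lim_seq_incr_1 (fun n => (/ INR n)%R)).
  apply (is_lim_seq_inv _ p_infty); [apply is_lim_seq_INR|discriminate].
Qed.

Lemma ex_series_inv_sq (r : nat -> R) (K : R) :
  (forall n, (Rabs (r n) <= K * / INR (S n) ^ 2)%R) -> ex_series r.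
Proof.
  intros H.
  apply (@ex_series_le R_AbsRing R_CompleteNormedModule) with
    (b := fun n => (K * (tau (S n) - tau n))%R).
  - intros n. eapply Rle_trans; [exact (H n)|].
    apply Rmult_le_compat_l; [|apply tau_step].
    specialize (H 0%nat). simpl in H. pose proof (Rabs_pos (r O)). lra.
  - apply (@ex_series_scal R_AbsRing R_NormedModule K (fun n => (tau (S n) - tau n)%R)).
    exists 2%R. unfold is_series.
    change (is_lim_seq (sum_n (fun n => (tau (S n) - tau n)%R)) 2).
    apply (is_lim_seq_ext (fun n => tau (S n))).
    + intros n. induction n.
      * rewrite sum_O, tau_O. ring.
      * rewrite sum_Sn, <- IHn. unfold plus; simpl. ring.
    + unfold tau. replace (Finite 2) with (Finite (2 - 2 * 0)) by (f_equal; ring).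
      apply is_lim_seq_minus'; [apply is_lim_seq_const|].
      apply is_lim_seq_mult'; [apply is_lim_seq_const|].
      exact (proj1 (is_lim_seq_incr_1 (fun n => (/ INR (S n))%R) 0) is_lim_seq_inv_INR_S).
Qed.

Lemma Csum_inv_sq (u : nat -> C) (K : R) :
  (forall n, (Cmod (u n) <= K * / INR (S n) ^ 2)%R) -> exists l, Csum u l.
Proof.
  intros H.
  destruct (ex_series_inv_sq (fun n => Re (u n)) K) as [x Hx].
  { intros n. eapply Rle_trans; [apply re_le_Cmod|apply H]. }
  destruct (ex_series_inv_sq (fun n => Im (u n)) K) as [y Hy].
  { intros n. eapply Rle_trans; [apply Im_le_Cmod|apply H]. }
  exists (x, y). apply Clim_decr. split; simpl Re; simpl Im.
  - eapply is_lim_seq_ext; [|exact Hx]. intros n. apply sum_n_Re_Im.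
  - eapply is_lim_seq_ext; [|exact Hy]. intros n. apply sum_n_Re_Im.
Qed.

Lemma product_bounded (P w : nat -> C) (K : R) :
  (0 <= K)%R ->
  (forall n, P (S n) = P n * (1 + w n)) ->
  (forall n, (Cmod (w n) <= K * / INR (S n) ^ 2)%R) ->
  forall n, (Cmod (P n) <= Cmod (P O) * exp (2 * K))%R.
Proof.
  intros HK HP Hw.
  assert (G : forall n, (Cmod (P n) <= Cmod (P O) * exp (K * tau n))%R).
  { induction n.
    - rewrite tau_O, Rmult_0_r, exp_0. lra.
    - rewrite HP, Cmod_mult.
      replace (K * tau (S n))%R with (K * tau n + K * (tau (S n) - tau n))%R by ring.
      rewrite exp_plus, <- Rmult_assoc.
      apply Rmult_le_compat; try apply Cmod_ge_0; [exact IHn|].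
      eapply Rle_trans; [apply Cmod_triangle|]. rewrite Cmod_1.
      eapply Rle_trans; [|apply exp_ineq1_le].
      apply Rplus_le_compat_l. eapply Rle_trans; [apply Hw|].
      apply Rmult_le_compat_l; [exact HK|apply tau_step]. }
  intros n. eapply Rle_trans; [apply G|].
  apply Rmult_le_compat_l; [apply Cmod_ge_0|]. pose proof (tau_le n) as Ht.
  assert (E : (K * tau n <= 2 * K)%R)
    by (rewrite (Rmult_comm 2 K); apply Rmult_le_compat_l; lra).
  destruct E as [E|E]; [left; now apply exp_increasing|rewrite E; lra].
Qed.

Lemma product_converges (P w : nat -> C) (K : R) :
  (0 <= K)%R ->
  (forall n, P (S n) = P n * (1 + w n)) ->
  (forall n, (Cmod (w n) <= K * / INR (S n) ^ 2)%R) ->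
  exists l, Clim P l.
Proof.
  intros HK HP Hw.
  destruct (Csum_inv_sq (fun n => P (S n) - P n) (Cmod (P O) * exp (2 * K) * K))
    as [l Hl].
  - intros n. rewrite HP. replace (P n * (1 + w n) - P n) with (P n * w n) by ring.
    rewrite Cmod_mult, Rmult_assoc.
    apply Rmult_le_compat; try apply Cmod_ge_0; [|apply Hw].
    now apply product_bounded with w.
  - exists (l + P O). now apply Csum_telescope_inv.
Qed.

(** The inverses 1 / P n form a product of the same kind, so they converge too,
    and the two limits have product 1. *)
Lemma product_limit_neq_0 (P q : nat -> C) (K M : R) :
  P O <> 0 ->
  (forall n, P (S n) = P n * q n) ->
  (forall n, q n <> 0) ->
  (forall n, (Cmod (q n - 1) <= K * / INR (S n) ^ 2)%R) ->
  (forall n, (Cmod (/ q n) <= M)%R) ->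
  exists l, Clim P l /\ l <> 0.
Proof.
  intros H0 HP Hq Hw Hi.
  assert (HK : (0 <= K)%R).
  { specialize (Hw O). simpl in Hw. pose proof (Cmod_ge_0 (q O - 1)). lra. }
  assert (HM : (0 <= M)%R) by (eapply Rle_trans; [apply Cmod_ge_0|exact (Hi O)]).
  assert (HPn : forall n, P n <> 0).
  { induction n; [exact H0|]. rewrite HP. now apply Cmult_neq_0. }
  destruct (product_converges P (fun n => q n - 1) K) as [l Hl]; [exact HK| |exact Hw|].
  { intros n. rewrite HP. ring. }
  destruct (product_converges (fun n => / P n) (fun n => / q n * - (q n - 1)) (M * K))
    as [m Hm].
  - now apply Rmult_le_pos.
  - intros n. rewrite HP. field. split; [apply Hq|apply HPn].
  - intros n. rewrite Cmod_mult, Cmod_opp, Rmult_assoc.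
    apply Rmult_le_compat; try apply Cmod_ge_0; [apply Hi|apply Hw].
  - exists l. split; [exact Hl|]. intros E.
    assert (F : l * m = 1).
    { apply (Clim_unique (fun n => P n * / P n)); [now apply Clim_mult|].
      eapply Clim_ext; [|apply (Clim_const 1)].
      intros n. simpl. field. apply HPn. }
    apply C1_nz. rewrite <- F, E. ring.
Qed.

(** Differentiation of an infinite product at h = 0, with an error that is
    uniform in n, so that it survives the passage to the limit.  The bound
    follows from P (n + 1) - P n - h d n = P n (w n - h d n) + (P n - 1) h d n
    once P n is known to be bounded and P n - 1 to be O(h). *)
Lemma product_linearization (K : R) :
  (0 <= K)%R ->
  exists K', (0 <= K')%R /\
    forall (P w d : nat -> C) (h : C),
      (Cmod h <= 1)%R -> P O = 1 ->
      (forall n, P (S n) = P n * (1 + w n)) ->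
      (forall n, (Cmod (d n) <= K * / INR (S n) ^ 2)%R) ->
      (forall n, (Cmod (w n - h * d n) <= K * Cmod h ^ 2 * / INR (S n) ^ 2)%R) ->
      forall n, (Cmod (P n - (1 + h * psum d n)) <= K' * Cmod h ^ 2)%R.
Proof.
  intros HK. set (M := exp (2 * (2 * K))).
  assert (HM : (0 < M)%R) by apply exp_pos.
  exists (2 * (M * (K + 4 * K ^ 2)))%R. split.
  { repeat apply Rmult_le_pos; try lra. nra. }
  intros P w d h Hh H0 HP Hd Hw.
  set (eta := Cmod h) in *.
  assert (Heta : (0 <= eta)%R) by apply Cmod_ge_0.
  assert (Hsq : forall n, (0 < / INR (S n) ^ 2)%R).
  { intros n. apply Rinv_0_lt_compat, pow_lt, INR_S_pos. }
  assert (Hw1 : forall n, (Cmod (w n) <= 2 * K * eta * / INR (S n) ^ 2)%R).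
  { intros n. replace (w n) with ((w n - h * d n) + h * d n) by ring.
    eapply Rle_trans; [apply Cmod_triangle|]. rewrite Cmod_mult. fold eta.
    specialize (Hw n). specialize (Hd n). specialize (Hsq n).
    set (x := (/ INR (S n) ^ 2)%R) in *.
    assert (eta * Cmod (d n) <= eta * (K * x))%R by (apply Rmult_le_compat_l; lra).
    assert (K * eta ^ 2 * x <= K * eta * x)%R.
    { apply Rmult_le_compat_r; [lra|]. apply Rmult_le_compat_l; [lra|]. nra. }
    lra. }
  assert (HPb : forall n, (Cmod (P n) <= M)%R).
  { intros n. replace M with (Cmod (P O) * exp (2 * (2 * K)))%R
      by (rewrite H0, Cmod_1; unfold M; ring).
    apply (product_bounded P w (2 * K)); [lra|exact HP|].
    intros k. eapply Rle_trans; [apply Hw1|].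
    apply Rmult_le_compat_r; [left; apply Hsq|]. nra. }
  assert (HP1 : forall n, (Cmod (P n - 1) <= 2 * (M * (2 * K * eta)))%R).
  { intros n. rewrite <- H0. apply drift_bound.
    - repeat apply Rmult_le_pos; lra.
    - intros k. rewrite HP. replace (P k * (1 + w k) - P k) with (P k * w k) by ring.
      rewrite Cmod_mult, Rmult_assoc.
      apply Rmult_le_compat; try apply Cmod_ge_0; [apply HPb|apply Hw1]. }
  intros n.
  replace (P n - (1 + h * psum d n))
    with (P n - (1 + h * psum d n) - (P O - (1 + h * psum d O)))
    by (simpl; rewrite H0; ring).
  rewrite Rmult_assoc.
  apply (drift_bound (fun k => P k - (1 + h * psum d k))).
  { repeat apply Rmult_le_pos; try lra; try apply pow2_ge_0. nra. }
  intros k. simpl psum. rewrite HP.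
  replace (P k * (1 + w k) - (1 + h * (psum d k + d k)) - (P k - (1 + h * psum d k)))
    with (P k * (w k - h * d k) + (P k - 1) * (h * d k)) by ring.
  eapply Rle_trans; [apply Cmod_triangle|]. rewrite !Cmod_mult. fold eta.
  specialize (Hw k). specialize (Hd k). specialize (Hsq k).
  specialize (HPb k). specialize (HP1 k).
  set (x := (/ INR (S k) ^ 2)%R) in *.
  assert (Cmod (P k) * Cmod (w k - h * d k) <= M * (K * eta ^ 2 * x))%R
    by (apply Rmult_le_compat; auto; apply Cmod_ge_0).
  assert (Cmod (P k - 1) * (eta * Cmod (d k))
          <= 2 * (M * (2 * K * eta)) * (eta * (K * x)))%R.
  { apply Rmult_le_compat; auto; try apply Cmod_ge_0.
    - apply Rmult_le_pos; [lra|apply Cmod_ge_0].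
    - apply Rmult_le_compat_l; lra. }
  nra.
Qed.

(** * The complex exponential *)

(** The complex exponential; [RCpower t z] is [cexp (z ln t)]. *)
Definition cexp (z : C) : C := RtoC (exp (Re z)) * (cos (Im z), sin (Im z)).

Lemma cexp_plus (z w : C) : cexp (z + w) = cexp z * cexp w.
Proof.
  unfold cexp. destruct z as [a b], w as [c d]. simpl.
  rewrite exp_plus, cos_plus, sin_plus.
  unfold RtoC, Cmult; simpl. f_equal; ring.
Qed.

Lemma cexp_0 : cexp 0 = 1.
Proof.
  unfold cexp. simpl. rewrite exp_0, cos_0, sin_0.
  unfold RtoC, Cmult; simpl. f_equal; ring.
Qed.

Lemma cexp_neq_0 (z : C) : cexp z <> 0.
Proof.
  intros E. apply C1_nz. rewrite <- cexp_0.
  replace (RtoC 0) with (z + - z) at 1 by ring. rewrite cexp_plus, E. ring.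
Qed.

Lemma cexp_opp (z : C) : cexp (- z) = / cexp z.
Proof.
  assert (E : cexp z * cexp (- z) = 1).
  { rewrite <- cexp_plus. replace (z + - z) with (RtoC 0) by ring. apply cexp_0. }
  transitivity (/ cexp z * (cexp z * cexp (- z))).
  - field. apply cexp_neq_0.
  - rewrite E. ring.
Qed.

Lemma exp_le (x y : R) : (x <= y)%R -> (exp x <= exp y)%R.
Proof. intros [H|H]; [left; now apply exp_increasing|rewrite H; lra]. Qed.

Lemma Cmod_cexp_le (z : C) : (Cmod (cexp z) <= exp (Cmod z))%R.
Proof.
  unfold cexp. rewrite Cmod_mult, Cmod_R, Rabs_pos_eq by (left; apply exp_pos).
  assert (E : Cmod (cos (Im z), sin (Im z)) = 1%R).
  { unfold Cmod; simpl fst; simpl snd.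
    replace (cos (Im z) ^ 2 + sin (Im z) ^ 2)%R with 1%R; [apply sqrt_1|].
    pose proof (sin2_cos2 (Im z)). unfold Rsqr in *. simpl. lra. }
  rewrite E, Rmult_1_r. apply exp_le.
  eapply Rle_trans; [apply Rle_abs|apply re_le_Cmod].
Qed.

Lemma exp_quadratic (x : R) :
  (Rabs x <= / 2)%R -> (0 <= exp x - 1 - x <= 2 * x ^ 2)%R.
Proof.
  intros H. apply Rabs_le_between in H. pose proof (exp_ineq1_le x).
  pose proof (exp_ineq1_le (- x)) as H1.
  assert (E : (exp x * exp (- x) = 1)%R)
    by (rewrite <- exp_plus, Rplus_opp_r; apply exp_0).
  pose proof (exp_pos x). split; [lra|].
  assert (exp x * (1 - x) <= 1)%R by (rewrite <- E; apply Rmult_le_compat_l; lra).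
  assert ((1 - x) * exp x <= (1 - x) * (1 + x + 2 * x ^ 2))%R; [|nra].
  assert (0 <= x ^ 2 * (1 - 2 * x))%R by (apply Rmult_le_pos; [apply pow2_ge_0|lra]).
  lra.
Qed.

Lemma sin_abs_le (y : R) : (Rabs (sin y) <= Rabs y)%R.
Proof.
  destruct (MVT_gen sin 0 y cos) as [c [_ E]].
  - intros x _. apply is_derive_Reals, derivable_pt_lim_sin.
  - intros x _. apply continuity_sin.
  - rewrite sin_0, !Rminus_0_r in E. rewrite E, Rabs_mult.
    pose proof (COS_bound c). assert (Rabs (cos c) <= 1)%R by (apply Rabs_le; lra).
    pose proof (Rabs_pos y). nra.
Qed.

Lemma cos_quadratic (y : R) : (Rabs (cos y - 1) <= y ^ 2)%R.
Proof.
  replace (cos y) with (1 - 2 * sin (y / 2) * sin (y / 2))%R.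
  - pose proof (sin_abs_le (y / 2)) as H.
    apply Rsqr_le_abs_1 in H. unfold Rsqr in H.
    apply Rabs_le. split; nra.
  - rewrite <- cos_2a_sin. f_equal. field.
Qed.

Lemma sin_quadratic (y : R) : (Rabs y <= 1)%R -> (Rabs (sin y - y) <= y ^ 2)%R.
Proof.
  intros Hy.
  destruct (MVT_gen (fun x => (sin x - x)%R) 0 y (fun x => (cos x - 1)%R)) as [c [Hc E]].
  - intros x _. auto_derive; [exact I|ring].
  - intros x _. apply continuity_pt_minus; [apply continuity_sin|].
    apply derivable_continuous_pt, derivable_pt_id.
  - rewrite sin_0, !Rminus_0_r in E. rewrite E, Rabs_mult.
    pose proof (cos_quadratic c) as H.
    assert (Hc' : (Rabs c <= Rabs y)%R).
    { unfold Rmin, Rmax in Hc. destruct (Rle_dec 0 y);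
        unfold Rabs; destruct (Rcase_abs c), (Rcase_abs y); lra. }
    pose proof (Rabs_pos c). pose proof (Rabs_pos y).
    assert (E1 : (c ^ 2 <= Rabs y)%R).
    { rewrite <- (pow2_abs c). nra. }
    rewrite <- (pow2_abs y). nra.
Qed.

(** Near 0 this is Taylor's formula; for 1/2 < |z| <= r the left side is
    bounded and |z|^2 is at least 1/4. *)
Lemma cexp_quadratic (r : R) :
  exists K, (0 <= K)%R /\
    forall z, (Cmod z <= r)%R -> (Cmod (cexp z - 1 - z) <= K * Cmod z ^ 2)%R.
Proof.
  exists (20 + 4 * (exp r + 1 + Rabs r))%R.
  pose proof (exp_pos r). pose proof (Rabs_pos r).
  split; [lra|]. intros z Hz. pose proof (Cmod_ge_0 z) as Hz0.
  destruct (Rle_dec (Cmod z) (/ 2)) as [Hs|Hs].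
  - assert (HR := re_le_Cmod z). assert (HI := Im_le_Cmod z).
    assert (Cmod (cexp z - 1 - z) <= 20 * Cmod z ^ 2)%R.
    { set (t := Cmod z) in *.
      assert (E1 := exp_quadratic (Re z) ltac:(lra)).
      assert (E2 := cos_quadratic (Im z)).
      assert (E3 := sin_quadratic (Im z) ltac:(lra)).
      assert (X : (Re z ^ 2 <= t ^ 2)%R).
      { rewrite <- pow2_abs. apply pow_incr. split; [apply Rabs_pos|exact HR]. }
      assert (Y : (Im z ^ 2 <= t ^ 2)%R).
      { rewrite <- (pow2_abs (Im z)). apply pow_incr. split; [apply Rabs_pos|exact HI]. }
      eapply Rle_trans; [apply Cmod_le_Re_Im|].
      replace (Re (cexp z - 1 - z))
        with ((exp (Re z) - 1 - Re z) + exp (Re z) * (cos (Im z) - 1))%R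
        by (unfold cexp, Re, Im; simpl; ring).
      replace (Im (cexp z - 1 - z))
        with (exp (Re z) * (sin (Im z) - Im z) + (exp (Re z) - 1) * Im z)%R
        by (unfold cexp, Re, Im; simpl; ring).
      set (e := exp (Re z)) in *. set (x := Re z) in *. set (y := Im z) in *.
      set (C1 := (cos y - 1)%R) in *. set (S1 := (sin y - y)%R) in *.
      assert (He : (0 < e <= 2)%R).
      { split; [apply exp_pos|]. apply Rabs_le_between in HR.
        assert (t ^ 2 <= / 4)%R by nra. lra. }
      assert (B1 : (Rabs (e * C1) <= 2 * t ^ 2)%R).
      { rewrite Rabs_mult, (Rabs_pos_eq e) by lra.
        pose proof (Rabs_pos C1). nra. }
      assert (B2 : (Rabs (e * S1) <= 2 * t ^ 2)%R).
      { rewrite Rabs_mult, (Rabs_pos_eq e) by lra.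
        pose proof (Rabs_pos S1). nra. }
      assert (B3 : (Rabs (e - 1) <= 2 * t)%R).
      { apply Rabs_le_between in HR. apply Rabs_le. split; [lra|].
        assert (t ^ 2 <= t * / 2)%R by nra. lra. }
      assert (B4 : (Rabs ((e - 1) * y) <= 2 * t * t)%R).
      { rewrite Rabs_mult. apply Rmult_le_compat; auto; apply Rabs_pos. }
      pose proof (Rabs_triang (e - 1 - x) (e * C1)).
      pose proof (Rabs_triang (e * S1) ((e - 1) * y)).
      rewrite (Rabs_pos_eq (e - 1 - x)) in * by lra. nra. }
    assert (0 <= 4 * (exp r + 1 + Rabs r) * Cmod z ^ 2)%R
      by (apply Rmult_le_pos; [lra|apply pow2_ge_0]).
    lra.
  - assert (/ 4 <= Cmod z ^ 2)%R by nra.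
    assert (Cmod (cexp z - 1 - z) <= exp r + 1 + Rabs r)%R.
    { eapply Rle_trans; [apply Cmod_minus_le|].
      eapply Rle_trans; [apply Rplus_le_compat_r, Cmod_minus_le|]. rewrite Cmod_1.
      pose proof (Cmod_cexp_le z). pose proof (exp_le _ _ Hz). pose proof (Rle_abs r).
      lra. }
    nra.
Qed.

(** * Euler's limit for the Gamma function *)

(** This one estimate gives both the convergence of Euler's product (with
    h = z, m = x = 1 / (n + 1)) and its differentiability at z (with h the
    increment and m = 1 / (z + n + 1)).  It rests on
    cexp (h l) - (1 + h m) (1 + h (l - m))
    = (cexp (h l) - 1 - h l) - h^2 m (l - m). *)
Lemma gamma_factor_expansion (A r c : R) :
  (0 <= A)%R -> (0 < c)%R ->
  exists K, (0 <= K)%R /\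
    forall (h l m : C) (x : R),
      (Cmod h <= r)%R -> (0 < x <= 1)%R ->
      (Cmod l <= A * x)%R -> (Cmod m <= A * x)%R -> (Cmod (l - m) <= A * x ^ 2)%R ->
      (c <= Cmod (1 + h * m))%R ->
      (Cmod (cexp (h * l) / (1 + h * m) - (1 + h * (l - m))) <= K * Cmod h ^ 2 * x ^ 2)%R.
Proof.
  intros HA Hc. destruct (cexp_quadratic (r * A)) as [K1 [HK1 HE]].
  exists ((K1 * A ^ 2 + A ^ 2) / c)%R. split.
  { apply Rmult_le_pos; [nra|left; now apply Rinv_0_lt_compat]. }
  intros h l m x Hh Hx Hl Hm Hlm Hcm.
  assert (Hne : 1 + h * m <> 0) by (apply Cmod_gt_0; lra).
  replace (cexp (h * l) / (1 + h * m) - (1 + h * (l - m)))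
    with (((cexp (h * l) - 1 - h * l) - h * h * (m * (l - m))) / (1 + h * m))
    by (field; exact Hne).
  rewrite Cmod_div by exact Hne.
  set (eta := Cmod h) in *. assert (0 <= eta)%R by apply Cmod_ge_0.
  assert (Ax : (0 <= A * x)%R) by nra.
  assert (B1 : (Cmod (cexp (h * l) - 1 - h * l) <= K1 * A ^ 2 * eta ^ 2 * x ^ 2)%R).
  { assert (E : (Cmod (h * l) <= eta * (A * x))%R).
    { rewrite Cmod_mult. apply Rmult_le_compat_l; auto. }
    eapply Rle_trans.
    - apply HE. eapply Rle_trans; [exact E|]. apply Rmult_le_compat; nra.
    - replace (K1 * A ^ 2 * eta ^ 2 * x ^ 2)%R with (K1 * (eta * (A * x)) ^ 2)%R by ring.
      apply Rmult_le_compat_l; [exact HK1|]. apply pow_incr.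
      split; [apply Cmod_ge_0|exact E]. }
  assert (B2 : (Cmod (h * h * (m * (l - m))) <= A ^ 2 * eta ^ 2 * x ^ 2)%R).
  { rewrite !Cmod_mult. fold eta.
    replace (A ^ 2 * eta ^ 2 * x ^ 2)%R with (eta * eta * (A * (A * x ^ 2)))%R by ring.
    apply Rmult_le_compat_l; [nra|].
    apply Rmult_le_compat; auto; try apply Cmod_ge_0.
    eapply Rle_trans; [exact Hm|]. nra. }
  replace ((K1 * A ^ 2 + A ^ 2) / c * eta ^ 2 * x ^ 2)%R
    with ((K1 * A ^ 2 * eta ^ 2 * x ^ 2 + A ^ 2 * eta ^ 2 * x ^ 2) * / c)%R
    by (field; lra).
  apply Rmult_le_compat.
  - apply Cmod_ge_0.
  - left. apply Rinv_0_lt_compat. lra.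
  - eapply Rle_trans; [apply Cmod_minus_le|]. lra.
  - now apply Rinv_le_contravar.
Qed.

(** The exponent picked up by n^z from n to n + 1.  Since [ln 0] is 0 by convention,
    it is 0 for n = 0 and the first n steps add up to ln n. *)
Definition ln_step (n : nat) : R := (ln (INR (S n)) - ln (INR n))%R.

Lemma ln_0 : ln 0 = 0%R.
Proof.
  unfold ln. destruct (Rlt_dec 0 0) as [H|H]; [exfalso; exact (Rlt_irrefl 0 H)|].
  reflexivity.
Qed.

Lemma ln_le_sub (x : R) : (0 < x)%R -> (ln x <= x - 1)%R.
Proof.
  intros Hx. pose proof (exp_ineq1_le (ln x)) as H. rewrite exp_ln in H; lra.
Qed.

Lemma ln_step_bound (n : nat) :
  (Rabs (ln_step n - / INR (S n)) <= 2 * / INR (S n) ^ 2)%R.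
Proof.
  unfold ln_step. destruct n as [|n].
  - simpl. rewrite ln_1, ln_0. rewrite Rabs_left; lra.
  - pose proof (INR_S_pos n) as Hn. rewrite (S_INR (S n)).
    assert (H1 : (1 <= INR (S n))%R) by (rewrite S_INR; pose proof (pos_INR n); lra).
    set (x := INR (S n)) in *. rewrite <- ln_div by lra.
    pose proof (ln_le_sub ((x + 1) / x)) as U.
    pose proof (ln_le_sub (x / (x + 1))) as L.
    assert (E : ln (x / (x + 1)) = (- ln ((x + 1) / x))%R)
      by (rewrite !ln_div by lra; ring).
    rewrite E in L.
    assert (P1 : (0 < (x + 1) / x)%R) by (apply Rdiv_lt_0_compat; lra).
    assert (P2 : (0 < x / (x + 1))%R) by (apply Rdiv_lt_0_compat; lra).
    specialize (U P1). specialize (L P2).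
    replace ((x + 1) / x - 1)%R with (/ x)%R in U by (field; lra).
    replace (x / (x + 1) - 1)%R with (- / (x + 1))%R in L by (field; lra).
    assert (Q : (/ x - / (x + 1) <= 2 * / (x + 1) ^ 2)%R).
    { replace (2 * / (x + 1) ^ 2)%R
        with (/ x - / (x + 1) + (x - 1) / (x * (x + 1) ^ 2))%R by (field; lra).
      assert (0 <= (x - 1) / (x * (x + 1) ^ 2))%R; [|lra].
      apply Rdiv_le_0_compat; [lra|]. apply Rmult_lt_0_compat; [lra|]. apply pow_lt; lra. }
    assert (0 < / (x + 1) ^ 2)%R by (apply Rinv_0_lt_compat, pow_lt; lra).
    apply Rabs_le. lra.
Qed.

Lemma inv_INR_S_le_1 (n : nat) : (0 < / INR (S n) <= 1)%R.
Proof.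
  pose proof (INR_S_pos n). split; [now apply Rinv_0_lt_compat|].
  rewrite <- Rinv_1. apply Rinv_le_contravar; [lra|].
  rewrite S_INR. pose proof (pos_INR n). lra.
Qed.

Lemma ln_step_abs_le (n : nat) : (Rabs (ln_step n) <= 3 * / INR (S n))%R.
Proof.
  replace (ln_step n) with ((ln_step n - / INR (S n)) + / INR (S n))%R by ring.
  eapply Rle_trans; [apply Rabs_triang|].
  pose proof (ln_step_bound n). pose proof (inv_INR_S_le_1 n) as H1.
  rewrite (Rabs_pos_eq (/ INR (S n))) by lra.
  rewrite <- pow_inv in *. nra.
Qed.

Lemma plus_INR_neq_0 (z : C) (n : nat) : ~ nonpos_int z -> z + INR n <> 0.
Proof.
  intros H E. apply H. exists n.
  replace z with (z + INR n - INR n) by ring. rewrite E. ring.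
Qed.

Lemma not_nonpos_int_neq_0 (z : C) : ~ nonpos_int z -> z <> 0.
Proof. intros H E. apply H. exists O. rewrite E. simpl. ring. Qed.

Lemma not_nonpos_int_shift (z : C) (n : nat) : ~ nonpos_int z -> ~ nonpos_int (z + INR n).
Proof.
  intros H [m E]. apply H. exists (n + m)%nat. rewrite plus_INR, RtoC_plus.
  replace z with (z + INR n - INR n) by ring. rewrite E. ring.
Qed.

Lemma not_nonpos_int_S (z : C) : ~ nonpos_int z -> ~ nonpos_int (z + 1).
Proof. exact (not_nonpos_int_shift z 1). Qed.

(** For large n the modulus is at least n - |z|; the finitely many other values
    are nonzero. *)
Lemma shift_lower_bound (z : C) :
  ~ nonpos_int z ->
  exists c, (0 < c <= 1)%R /\ forall n, (c * INR (S n) <= Cmod (z + INR n))%R.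
Proof.
  intros Hz.
  assert (F : forall N : nat, exists c, (0 < c)%R /\
            forall n, (n < N)%nat -> (c * INR (S n) <= Cmod (z + INR n))%R).
  { induction N as [|N [c [Hc IH]]].
    - exists 1%R. split; [lra|]. intros n Hn. lia.
    - pose proof (plus_INR_neq_0 z N Hz) as Hne. apply Cmod_gt_0 in Hne.
      exists (Rmin c (Cmod (z + INR N) / INR (S N))). split.
      + apply Rmin_glb_lt; [exact Hc|]. apply Rdiv_lt_0_compat; [exact Hne|apply INR_S_pos].
      + intros n Hn. pose proof (INR_S_pos n) as Hp.
        destruct (Nat.eq_dec n N) as [->|Hd].
        * eapply Rle_trans; [apply Rmult_le_compat_r; [lra|apply Rmin_r]|].
          right. field. lra.
        * eapply Rle_trans; [apply Rmult_le_compat_r; [lra|apply Rmin_l]|].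
          apply IH. lia. }
  destruct (nfloor_ex (2 * Cmod z + 1)) as [N [_ HN]].
  { pose proof (Cmod_ge_0 z). lra. }
  destruct (F (S N)) as [c [Hc H]].
  exists (Rmin c (/ 2)). split.
  { split; [apply Rmin_glb_lt; lra|]. eapply Rle_trans; [apply Rmin_r|lra]. }
  intros n. pose proof (INR_S_pos n) as Hp.
  destruct (Compare_dec.le_lt_dec (S N) n) as [Hn|Hn].
  - eapply Rle_trans; [apply Rmult_le_compat_r; [lra|apply Rmin_r]|].
    pose proof (Cmod_plus_ge (RtoC (INR n)) z) as G.
    rewrite Cmod_R, Rabs_pos_eq, Cplus_comm in G by apply pos_INR.
    apply le_INR in Hn. rewrite S_INR in *. lra.
  - eapply Rle_trans; [apply Rmult_le_compat_r; [lra|apply Rmin_l]|]. now apply H.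
Qed.

Lemma shift_inv_bound (z : C) :
  ~ nonpos_int z ->
  exists K, (0 <= K)%R /\ forall n, (Cmod (/ (z + INR n)) <= K * / INR (S n))%R.
Proof.
  intros Hz. destruct (shift_lower_bound z Hz) as [c [Hc H]].
  exists (/ c)%R. split; [left; apply Rinv_0_lt_compat; lra|].
  intros n. rewrite Cmod_inv by now apply plus_INR_neq_0.
  pose proof (INR_S_pos n). rewrite <- Rinv_mult.
  apply Rinv_le_contravar; [apply Rmult_lt_0_compat; lra|apply H].
Qed.

Lemma Clim_shift_inv (z : C) : ~ nonpos_int z -> Clim (fun n => / (z + INR n)) 0.
Proof.
  intros Hz. destruct (shift_inv_bound z Hz) as [K [_ H]].
  apply Clim_squeeze_0 with (m := fun n => (K * / INR (S n))%R); [now exists O|].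
  replace (Finite 0) with (Finite (K * 0)) by (f_equal; ring).
  apply is_lim_seq_mult'; [apply is_lim_seq_const|apply is_lim_seq_inv_INR_S].
Qed.

Lemma poch_neq_0 (z : C) (n : nat) : ~ nonpos_int z -> poch z n <> 0.
Proof.
  intros Hz. induction n; simpl; [apply C1_nz|].
  apply Cmult_neq_0; [exact IHn|now apply plus_INR_neq_0].
Qed.

Lemma poch_shift (z : C) (n : nat) : z * poch (z + 1) n = poch z n * (z + INR n).
Proof.
  induction n.
  - simpl. ring.
  - simpl poch. rewrite Cmult_assoc, IHn, RtoC_S. ring.
Qed.

Lemma RCpower_cexp (t : R) (z : C) : RCpower t z = cexp (z * ln t).
Proof.
  unfold RCpower, cexp. now rewrite re_scal_r, im_scal_r.
Qed.

(** Euler's approximation of Gamma: n! n^z / (z (z + 1) ... (z + n)). *)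
Definition Gamma_seq (z : C) (n : nat) : C :=
  INR (fact n) * RCpower (INR n) z / poch z (S n).

Lemma Gamma_seq_S (z : C) (n : nat) :
  ~ nonpos_int z ->
  Gamma_seq z (S n) = Gamma_seq z n * (cexp (z * ln_step n) / (1 + z * (/ INR (S n))%R)).
Proof.
  intros Hz. unfold Gamma_seq. rewrite !RCpower_cexp.
  replace (z * ln (INR (S n))) with (z * ln (INR n) + z * ln_step n)
    by (unfold ln_step; rewrite RtoC_minus; ring).
  rewrite cexp_plus.
  change (fact (S n)) with (S n * fact n)%nat. rewrite mult_INR, RtoC_mult.
  change (poch z (S (S n))) with (poch z (S n) * (z + INR (S n))).
  pose proof (poch_neq_0 z (S n) Hz) as H1.
  pose proof (plus_INR_neq_0 z (S n) Hz) as H2.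
  pose proof (RtoC_S_neq_0 n) as H3.
  rewrite RtoC_inv by (pose proof (INR_S_pos n); lra).
  field. repeat split; auto.
  intros E. apply H2. rewrite <- E. ring.
Qed.

Lemma gamma_factor_lower_bound (z : C) (c : R) (n : nat) :
  (forall k, (c * INR (S k) <= Cmod (z + INR k))%R) -> (0 < c)%R ->
  (c <= Cmod (1 + z * (/ INR (S n))%R))%R.
Proof.
  intros H Hc. pose proof (INR_S_pos n) as Hn.
  replace (1 + z * (/ INR (S n))%R) with ((z + INR (S n)) / INR (S n)).
  - rewrite Cmod_div by apply RtoC_S_neq_0.
    rewrite Cmod_R, Rabs_pos_eq by lra.
    apply Rle_div_r; [lra|]. eapply Rle_trans; [|apply H].
    apply Rmult_le_compat_l; [lra|]. rewrite (S_INR (S n)). lra.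
  - rewrite RtoC_inv by lra. field. apply RtoC_S_neq_0.
Qed.

(** The factor that leads from n to n + 1 is 1 + O(1 / (n + 1)^2). *)
Lemma Gamma_seq_converges (z : C) :
  ~ nonpos_int z -> exists l, Clim (Gamma_seq z) l /\ l <> 0.
Proof.
  intros Hz. destruct (shift_lower_bound z Hz) as [c [Hc Hlow]].
  assert (Hb : forall n, (c <= Cmod (1 + z * (/ INR (S n))%R))%R)
    by (intros n; apply gamma_factor_lower_bound; [exact Hlow|lra]).
  assert (Hne : forall n, 1 + z * (/ INR (S n))%R <> 0)
    by (intros n; apply Cmod_gt_0; specialize (Hb n); lra).
  destruct (gamma_factor_expansion 3 (Cmod z) c) as [K [HK HE]]; [lra|lra|].
  apply product_limit_neq_0 with
    (q := fun n => cexp (z * ln_step n) / (1 + z * (/ INR (S n))%R))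
    (K := (K * Cmod z ^ 2 + 2 * Cmod z)%R)
    (M := ((1 + Cmod z) * exp (Cmod z * 3))%R).
  - unfold Gamma_seq. rewrite RCpower_cexp. apply Cdiv_neq_0; [|now apply poch_neq_0].
    apply Cmult_neq_0; [apply fact_neq_0_C|apply cexp_neq_0].
  - intros n. now apply Gamma_seq_S.
  - intros n. apply Cdiv_neq_0; [apply cexp_neq_0|apply Hne].
  - intros n. pose proof (inv_INR_S_le_1 n) as Hx.
    pose proof (ln_step_bound n) as L1. pose proof (ln_step_abs_le n) as L2.
    rewrite <- pow_inv in *. set (x := (/ INR (S n))%R) in *.
    assert (Hx2 : (0 < x ^ 2)%R) by (apply pow_lt; lra).
    assert (E : (Cmod (z * (ln_step n - x)) <= Cmod z * (2 * x ^ 2))%R).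
    { rewrite <- RtoC_minus, Cmod_mult, Cmod_R.
      apply Rmult_le_compat_l; [apply Cmod_ge_0|exact L1]. }
    replace (cexp (z * ln_step n) / (1 + z * x) - 1)
      with ((cexp (z * ln_step n) / (1 + z * x) - (1 + z * (ln_step n - x)))
            + z * (ln_step n - x)) by ring.
    eapply Rle_trans; [apply Cmod_triangle|].
    specialize (HE z (ln_step n) x x (Rle_refl _) Hx).
    rewrite <- RtoC_minus, !Cmod_R, (Rabs_pos_eq x) in HE by lra.
    rewrite <- RtoC_minus in *.
    assert (Cmod (cexp (z * ln_step n) / (1 + z * x) - (1 + z * RtoC (ln_step n - x)))
            <= K * Cmod z ^ 2 * x ^ 2)%R.
    { apply HE; try lra. apply Hb. }
    lra.
  - intros n. pose proof (inv_INR_S_le_1 n) as Hx.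
    pose proof (ln_step_abs_le n) as L2. specialize (Hne n).
    set (x := (/ INR (S n))%R) in *.
    replace (/ (cexp (z * ln_step n) / (1 + z * x)))
      with ((1 + z * x) * cexp (z * (- ln_step n)%R)).
    + rewrite Cmod_mult. apply Rmult_le_compat; try apply Cmod_ge_0.
      * eapply Rle_trans; [apply Cmod_triangle|].
        rewrite Cmod_1, Cmod_mult, Cmod_R, Rabs_pos_eq by lra.
        pose proof (Cmod_ge_0 z). nra.
      * eapply Rle_trans; [apply Cmod_cexp_le|]. apply exp_le.
        rewrite Cmod_mult, Cmod_R, Rabs_Ropp.
        apply Rmult_le_compat_l; [apply Cmod_ge_0|]. lra.
    + replace (z * (- ln_step n)%R) with (- (z * ln_step n)) by (rewrite RtoC_opp; ring).
      rewrite cexp_opp. field. split; [exact Hne|apply cexp_neq_0].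
Qed.

Lemma Gamma_limit (z : C) : ~ nonpos_int z -> Clim (Gamma_seq z) (Gamma z).
Proof.
  intros Hz. destruct (Gamma_seq_converges z Hz) as [l [Hl _]].
  unfold Gamma. fold (Gamma_seq z). now rewrite (Clim_CLim_seq _ _ Hl).
Qed.

Lemma Gamma_neq_0 (z : C) : ~ nonpos_int z -> Gamma z <> 0.
Proof.
  intros Hz. destruct (Gamma_seq_converges z Hz) as [l [Hl Hne]].
  now rewrite (Clim_unique _ _ _ (Gamma_limit z Hz) Hl).
Qed.

(** The approximations satisfy the functional equation up to the factor
    n / (z + n + 1), which tends to 1. *)
Lemma Gamma_S (z : C) : ~ nonpos_int z -> Gamma (z + 1) = z * Gamma z.
Proof.
  intros Hz. pose proof (not_nonpos_int_S z Hz) as Hz1.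
  apply (Clim_unique (Gamma_seq (z + 1))); [now apply Gamma_limit|].
  apply Clim_ext_loc with
    (u := fun n => z * Gamma_seq z n * (1 - (z + 1) * / ((z + 1) + INR n))).
  - exists 1%nat. intros n Hn. unfold Gamma_seq. rewrite !RCpower_cexp.
    replace ((z + 1) * ln (INR n)) with (z * ln (INR n) + ln (INR n)) by ring.
    rewrite cexp_plus.
    replace (cexp (ln (INR n))) with (RtoC (INR n)).
    2:{ unfold cexp. simpl. rewrite cos_0, sin_0, exp_ln.
        - unfold RtoC, Cmult; simpl. f_equal; ring.
        - apply lt_0_INR. lia. }
    pose proof (poch_shift z (S n)) as E.
    pose proof (poch_neq_0 z (S n) Hz) as H1.
    pose proof (poch_neq_0 (z + 1) (S n) Hz1) as H1'.
    pose proof (plus_INR_neq_0 (z + 1) n Hz1) as H2.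
    pose proof (not_nonpos_int_neq_0 z Hz) as H3.
    replace (poch (z + 1) (S n)) with (poch z (S n) * (z + INR (S n)) / z).
    2:{ rewrite <- E. field. exact H3. }
    rewrite RtoC_S. field. repeat split; auto.
    intros E2; apply H2; rewrite <- E2; ring.
  - replace (z * Gamma z) with (z * Gamma z * (1 - (z + 1) * 0)) by ring.
    apply Clim_mult; [apply Clim_scal; now apply Gamma_limit|].
    apply Clim_minus; [apply Clim_const|]. apply Clim_scal. now apply Clim_shift_inv.
Qed.

(** * The digamma function *)

(** The series of these terms sums to psi z + 1 / z. *)
Definition digamma_term (z : C) (n : nat) : C := ln_step n - / (z + INR (S n)).

(** Complex differentiability of w Gamma(w) at z, with an explicit derivative.
    The ratio of Euler's approximations at z + h and z, times (z + h) / z, is a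
    product that starts at 1 and to which [product_linearization] applies. *)
Lemma Gamma_expansion (z : C) :
  ~ nonpos_int z ->
  exists D K r, (0 < r)%R /\ Csum (digamma_term z) D /\
    forall h, (Cmod h <= r)%R ->
      z + h <> 0 /\
      (Cmod ((z + h) * Gamma (z + h) - z * Gamma z * (1 + h * D)) <= K * Cmod h ^ 2)%R.
Proof.
  intros Hz. destruct (shift_lower_bound z Hz) as [c [Hc Hlow]].
  destruct (shift_inv_bound z Hz) as [B [HB Hinv]].
  set (A := (3 + B + Cmod z * B)%R).
  assert (HzB : (0 <= Cmod z * B)%R) by (apply Rmult_le_pos; [apply Cmod_ge_0|lra]).
  assert (HA : (0 <= A)%R) by (unfold A; lra).
  assert (Hmu : forall n, (Cmod (/ (z + INR (S n))) <= B * / INR (S n))%R).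
  { intros n. eapply Rle_trans; [apply Hinv|]. apply Rmult_le_compat_l; [exact HB|].
    apply Rinv_le_contravar; [apply INR_S_pos|]. rewrite (S_INR (S n)). lra. }
  assert (Hd : forall n, (Cmod (digamma_term z n) <= A * / INR (S n) ^ 2)%R).
  { intros n. unfold digamma_term.
    pose proof (plus_INR_neq_0 z (S n) Hz) as Hne.
    pose proof (INR_S_pos n) as Hp. pose proof (inv_INR_S_le_1 n) as Hx.
    pose proof (ln_step_bound n) as L1. specialize (Hmu n).
    replace (ln_step n - / (z + INR (S n)))
      with (RtoC (ln_step n - / INR (S n)) + z * (/ (z + INR (S n)) * RtoC (/ INR (S n)))).
    - eapply Rle_trans; [apply Cmod_triangle|].
      rewrite !Cmod_mult, !Cmod_R, (Rabs_pos_eq (/ INR (S n))) by lra.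
      rewrite <- pow_inv in *. set (x := (/ INR (S n))%R) in *.
      assert (Cmod z * (Cmod (/ (z + INR (S n))) * x) <= Cmod z * (B * x * x))%R.
      { apply Rmult_le_compat_l; [apply Cmod_ge_0|]. apply Rmult_le_compat_r; lra. }
      assert (0 <= x ^ 2)%R by apply pow2_ge_0.
      unfold A. nra.
    - rewrite RtoC_minus, RtoC_inv by lra. field.
      split; [exact Hne|apply RtoC_S_neq_0]. }
  destruct (Csum_inv_sq _ _ Hd) as [D HD].
  destruct (gamma_factor_expansion A 1 (/ 2)) as [K1 [HK1 HE]]; [exact HA|lra|].
  destruct (product_linearization (A + K1)) as [K2 [HK2 HP]]; [lra|].
  exists D, (Cmod (z * Gamma z) * K2)%R, (c / 2)%R.
  split; [lra|]. split; [exact HD|]. intros h Hh.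
  assert (Hzh : forall n, z + h + INR n <> 0).
  { intros n. apply Cmod_gt_0.
    replace (z + h + INR n) with ((z + INR n) + h) by ring.
    eapply Rlt_le_trans; [|apply Cmod_plus_ge].
    specialize (Hlow n). rewrite S_INR in Hlow. pose proof (pos_INR n). nra. }
  assert (Hzh' : ~ nonpos_int (z + h)).
  { intros [n E]. apply (Hzh n). rewrite E. ring. }
  assert (Hzh0 : z + h <> 0) by now apply not_nonpos_int_neq_0.
  split; [exact Hzh0|].
  assert (Hz0 : z <> 0) by now apply not_nonpos_int_neq_0.
  assert (Hg : forall n, Gamma_seq z n <> 0).
  { intros n. unfold Gamma_seq. rewrite RCpower_cexp. apply Cdiv_neq_0; [|now apply poch_neq_0].
    apply Cmult_neq_0; [apply fact_neq_0_C|apply cexp_neq_0]. }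
  set (q := fun n => cexp (h * ln_step n) / (1 + h * / (z + INR (S n)))).
  set (P := fun n => (z + h) * Gamma_seq (z + h) n / (z * Gamma_seq z n)).
  assert (HPlim : Clim (fun n => z * Gamma_seq z n * (P n - (1 + h * psum (digamma_term z) n)))
                   ((z + h) * Gamma (z + h) - z * Gamma z * (1 + h * D))).
  { apply Clim_ext with (fun n => (z + h) * Gamma_seq (z + h) n
                         - z * Gamma_seq z n * (1 + h * psum (digamma_term z) n)).
    - intros n. unfold P. field. split; [apply Hg|exact Hz0].
    - apply Clim_minus; [apply Clim_scal; now apply Gamma_limit|].
      apply Clim_mult; [apply Clim_scal; now apply Gamma_limit|].
      apply Clim_plus; [apply Clim_const|]. apply Clim_scal. exact HD. }
  assert (HPb : forall n, (Cmod (P n - (1 + h * psum (digamma_term z) n))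
                           <= K2 * Cmod h ^ 2)%R).
  { apply (HP P (fun n => q n - 1) (digamma_term z) h).
    - lra.
    - unfold P, Gamma_seq. simpl. rewrite !RCpower_cexp. simpl INR. rewrite ln_0.
      replace ((z + h) * 0) with (z * 0) by ring. field.
      repeat split; auto; try apply cexp_neq_0; try (rewrite Cplus_0_r; auto).
    - intros n. unfold P. rewrite (Gamma_seq_S z) by exact Hz.
      rewrite (Gamma_seq_S (z + h)) by exact Hzh'.
      replace ((z + h) * ln_step n) with (z * ln_step n + h * ln_step n) by ring.
      rewrite cexp_plus. unfold q.
      pose proof (plus_INR_neq_0 z (S n) Hz) as N1.
      pose proof (Hzh (S n)) as N2. pose proof (RtoC_S_neq_0 n) as N3.
      pose proof (cexp_neq_0 (z * ln_step n)) as N4.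
      pose proof (INR_S_pos n).
      rewrite RtoC_inv by lra. field.
      repeat split; auto.
      intros E. apply N2. rewrite <- E. ring.
    - intros n. eapply Rle_trans; [apply Hd|].
      apply Rmult_le_compat_r; [|lra]. left. apply Rinv_0_lt_compat, pow_lt, INR_S_pos.
    - intros n. unfold q. pose proof (inv_INR_S_le_1 n) as Hx.
      pose proof (ln_step_abs_le n) as L2. specialize (Hmu n). specialize (Hd n).
      pose proof (plus_INR_neq_0 z (S n) Hz) as N1.
      rewrite <- pow_inv in *. unfold digamma_term in *.
      replace (cexp (h * ln_step n) / (1 + h * / (z + INR (S n))) - 1
               - h * (ln_step n - / (z + INR (S n))))
        with (cexp (h * ln_step n) / (1 + h * / (z + INR (S n)))
              - (1 + h * (ln_step n - / (z + INR (S n))))) by ring.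
      eapply Rle_trans.
      + apply (HE h (ln_step n) (/ (z + INR (S n))) (/ INR (S n))%R); auto.
        * lra.
        * rewrite Cmod_R. eapply Rle_trans; [exact L2|].
          apply Rmult_le_compat_r; [lra|]. unfold A. lra.
        * eapply Rle_trans; [exact Hmu|].
          apply Rmult_le_compat_r; [lra|]. unfold A. lra.
        * eapply Rle_trans; [|apply Cmod_plus_ge]. rewrite Cmod_1, Cmod_mult, Cmod_inv by exact N1.
          assert (Cmod h * / Cmod (z + INR (S n)) <= / 2)%R; [|lra].
          specialize (Hlow (S n)). rewrite S_INR in Hlow. pose proof (INR_S_pos n).
          apply Cmod_gt_0 in N1. apply Rle_div_l; [exact N1|]. nra.
      + apply Rmult_le_compat_r; [apply pow2_ge_0|].
        apply Rmult_le_compat_r; [apply pow2_ge_0|]. lra. }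
  assert (Hlim := Clim_Cmod _ _ HPlim).
  assert (Hlim2 : is_lim_seq (fun n => (Cmod (z * Gamma_seq z n) * (K2 * Cmod h ^ 2))%R)
                    (Cmod (z * Gamma z) * (K2 * Cmod h ^ 2))%R).
  { apply is_lim_seq_mult'; [|apply is_lim_seq_const].
    apply Clim_Cmod, Clim_scal. now apply Gamma_limit. }
  rewrite Rmult_assoc.
  refine (is_lim_seq_le _ _ (Finite _) (Finite _) _ Hlim Hlim2).
  intros n. rewrite Cmod_mult. apply Rmult_le_compat_l; [apply Cmod_ge_0|apply HPb].
Qed.

Lemma digamma_Csum (z : C) :
  ~ nonpos_int z -> exists D, Csum (digamma_term z) D /\ digamma z = D - / z.
Proof.
  intros Hz. destruct (Gamma_expansion z Hz) as [D [K [r [Hr [HD HE]]]]].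
  exists D. split; [exact HD|].
  assert (Hz0 : z <> 0) by now apply not_nonpos_int_neq_0.
  pose proof (Gamma_neq_0 z Hz) as HG.
  assert (E : C_derive Gamma z = (z * Gamma z * D - Gamma z) / z).
  { set (h := fun n : nat => (/ (INR n + 1))%R).
    assert (Hh : forall n, (0 < h n)%R).
    { intros n. apply Rinv_0_lt_compat. pose proof (pos_INR n). lra. }
    assert (Hh0 : is_lim_seq h 0).
    { eapply is_lim_seq_ext; [|apply is_lim_seq_inv_INR_S].
      intros n. unfold h. now rewrite S_INR. }
    assert (HhC : Clim (fun n => RtoC (h n)) 0).
    { apply Clim_squeeze_0 with (m := h); [|exact Hh0]. exists O. intros n _.
      rewrite Cmod_R, Rabs_pos_eq; [lra|]. left; apply Hh. }
    assert (Hev : eventually (fun n => (h n <= r)%R)).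
    { apply is_lim_seq_spec in Hh0. destruct (Hh0 (mkposreal r Hr)) as [N HN].
      exists N. intros n Hn. specialize (HN n Hn). simpl in HN.
      rewrite Rminus_0_r in HN. apply Rabs_lt_between in HN. lra. }
    (* [Lim] is taken along the points Re z + 1 / (n + 1). *)
    transitivity (CLim_seq (fun n => (Gamma (z + h n) - Gamma z) / h n)).
    - unfold C_derive, C_lim, CLim_seq, Lim.
      assert (Q : forall n, ((Rbar_loc_seq (fst z) n, snd z) : C) = z + h n).
      { intros n. destruct z as [x y]. unfold h, RtoC, Cplus; simpl. f_equal. ring. }
      f_equal; f_equal; apply Lim_seq_ext; intros n; rewrite Q;
        replace (z + h n - z) with (RtoC (h n)) by ring; reflexivity.
    - apply Clim_CLim_seq.
      set (rho := fun n => (z + h n) * Gamma (z + h n) - z * Gamma z * (1 + h n * D)).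
      apply Clim_ext_loc with
        (u := fun n => (z * Gamma z * D - Gamma z + rho n / h n) / (z + h n)).
      + destruct Hev as [N HN]. exists N. intros n Hn. unfold rho.
        destruct (HE (h n)) as [Hne _].
        { rewrite Cmod_R, Rabs_pos_eq; [now apply HN|]. left; apply Hh. }
        field. split; [apply RtoC_neq_0; specialize (Hh n); lra|exact Hne].
      + replace ((z * Gamma z * D - Gamma z) / z)
          with ((z * Gamma z * D - Gamma z + 0) / (z + 0)) by (rewrite !Cplus_0_r; reflexivity).
        apply Clim_div; [now rewrite Cplus_0_r| |].
        * apply Clim_plus; [apply Clim_const|].
          apply Clim_squeeze_0 with (m := fun n => (K * h n)%R).
          -- destruct Hev as [N HN]. exists N. intros n Hn. specialize (Hh n).
             destruct (HE (h n)) as [_ Hb].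
             { rewrite Cmod_R, Rabs_pos_eq; [now apply HN|lra]. }
             fold (rho n) in Hb.
             rewrite Cmod_div by (apply RtoC_neq_0; lra).
             rewrite Cmod_R, Rabs_pos_eq in * by lra.
             apply Rle_div_l; [exact Hh|]. lra.
          -- replace (Finite 0) with (Finite (K * 0)) by (f_equal; ring).
             apply is_lim_seq_mult'; [apply is_lim_seq_const|exact Hh0].
        * apply Clim_plus; [apply Clim_const|exact HhC]. }
  unfold digamma. rewrite E. field. split; assumption.
Qed.

(** The shifted harmonic number 1/b + 1/(b + 1) + ... + 1/(b + n - 1). *)
Definition harmonic (b : C) (n : nat) : C := psum (fun j => / (b + INR j)) n.

Lemma digamma_limit (z : C) :
  ~ nonpos_int z -> Clim (fun n => ln (INR n) - harmonic z (S n)) (digamma z).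
Proof.
  intros Hz. destruct (digamma_Csum z Hz) as [D [HD ->]].
  eapply Clim_ext; [|exact (Clim_minus _ _ _ _ HD (Clim_const (/ z)))].
  intros n. unfold harmonic. rewrite psum_shift.
  change (RtoC (INR 0)) with (RtoC 0). rewrite Cplus_0_r.
  assert (E : psum (digamma_term z) n
              = ln (INR n) - psum (fun k => / (z + INR (S k))) n).
  { unfold digamma_term. induction n.
    - simpl. rewrite ln_0. ring.
    - change (psum (fun k => ln_step k - / (z + INR (S k))) (S n))
        with (psum (fun k => ln_step k - / (z + INR (S k))) n
              + (ln_step n - / (z + INR (S n)))).
      change (psum (fun k => / (z + INR (S k))) (S n))
        with (psum (fun k => / (z + INR (S k))) n + / (z + INR (S n))).
      rewrite IHn. unfold ln_step. rewrite RtoC_minus. ring. }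
  rewrite E. ring.
Qed.

Lemma digamma_S (z : C) : ~ nonpos_int z -> digamma (z + 1) = digamma z + / z.
Proof.
  intros Hz. pose proof (not_nonpos_int_S z Hz) as Hz1.
  apply (Clim_unique (fun n => ln (INR n) - harmonic (z + 1) (S n)));
    [now apply digamma_limit|].
  replace (digamma z + / z) with (digamma z + (/ z - 0)) by ring.
  apply Clim_ext with
    (fun n => (ln (INR n) - harmonic z (S n)) + (/ z - / (z + 1 + INR n))).
  - intros n. unfold harmonic.
    assert (E : psum (fun j => / (z + 1 + INR j)) (S n) =
                psum (fun j => / (z + INR j)) (S (S n)) - / z).
    { rewrite (psum_shift _ (S n)). change (RtoC (INR 0)) with (RtoC 0).
      rewrite Cplus_0_r.
      rewrite (psum_ext (fun j => / (z + 1 + INR j)) (fun k => / (z + INR (S k)))).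
      - ring.
      - intros k. rewrite RtoC_S. f_equal. ring. }
    rewrite E.
    change (psum (fun j => / (z + INR j)) (S (S n)))
      with (psum (fun j => / (z + INR j)) (S n) + / (z + INR (S n))).
    rewrite RtoC_S. replace (z + (INR n + 1)) with (z + 1 + INR n) by ring. ring.
  - apply Clim_plus; [now apply digamma_limit|].
    apply Clim_minus; [apply Clim_const|]. now apply Clim_shift_inv.
Qed.

Lemma digamma_plus_INR (b : C) (k : nat) :
  ~ nonpos_int b -> digamma (b + INR k) - digamma b = harmonic b k.
Proof.
  intros Hb. induction k.
  - simpl. rewrite Cplus_0_r. unfold harmonic. simpl. ring.
  - change (harmonic b (S k)) with (harmonic b k + / (b + INR k)).
    rewrite <- IHk, RtoC_S, Cplus_assoc.
    rewrite digamma_S by now apply not_nonpos_int_shift. ring.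
Qed.

(** The modulus grows at least like ln n, since [digamma_limit] keeps the
    difference bounded. *)
Lemma harmonic_diverges (b x : C) :
  ~ nonpos_int b -> is_lim_seq (fun n => Cmod (harmonic b n - x)) p_infty.
Proof.
  intros Hb. apply is_lim_seq_incr_1.
  destruct (Clim_bounded _ _ (digamma_limit b Hb)) as [K HK].
  apply is_lim_seq_le_p_loc with (u := fun n => (ln (INR n) + - (K + Cmod x))%R).
  - exists 1%nat. intros n Hn. specialize (HK n).
    assert (L : (0 <= ln (INR n))%R).
    { rewrite <- ln_1. apply Rcomplements.ln_le; [lra|]. apply (le_INR 1). lia. }
    pose proof (Cmod_minus_le (ln (INR n) - harmonic b (S n) + (harmonic b (S n) - x))
                  (ln (INR n) - harmonic b (S n))) as E1.
    pose proof (Cmod_triangle (harmonic b (S n) - x) (ln (INR n) - harmonic b (S n))) as E2.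
    replace (harmonic b (S n) - x + (ln (INR n) - harmonic b (S n)))
      with (ln (INR n) - x) in E2 by ring.
    pose proof (Cmod_plus_ge (ln (INR n)) (- x)) as E3.
    rewrite Cmod_opp, Cmod_R, Rabs_pos_eq in E3 by exact L.
    unfold Cminus in *. lra.
  - apply (is_lim_seq_plus _ _ p_infty (Finite (- (K + Cmod x))) p_infty).
    + apply (filterlim_comp _ _ _ INR ln _ (Rbar_locally p_infty)).
      * apply is_lim_seq_INR.
      * apply is_lim_ln_p.
    + apply is_lim_seq_const.
    + reflexivity.
Qed.

(** * Gauss's summation theorem *)

Definition hyp2F1_term (a c e : C) (n : nat) : C :=
  poch a n * poch c n / (poch e n * INR (fact n)).

Lemma hyp2F1_term_O (a c e : C) : hyp2F1_term a c e 0 = 1.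
Proof. unfold hyp2F1_term. simpl. field. Qed.

Lemma hyp2F1_term_S (a c e : C) (n : nat) :
  ~ nonpos_int e ->
  hyp2F1_term a c e (S n)
  = hyp2F1_term a c e n * ((a + INR n) * (c + INR n) / ((e + INR n) * (INR n + 1))).
Proof.
  intros He. unfold hyp2F1_term.
  change (fact (S n)) with (S n * fact n)%nat. rewrite mult_INR, RtoC_mult, RtoC_S.
  simpl poch.
  pose proof (poch_neq_0 e n He). pose proof (plus_INR_neq_0 e n He).
  pose proof (fact_neq_0_C n). pose proof (RtoC_S_neq_0 n) as H3. rewrite RtoC_S in H3.
  field. repeat split; auto.
Qed.

Lemma hyp2F1_term_e_S (a c e : C) (n : nat) :
  ~ nonpos_int e -> hyp2F1_term a c (e + 1) n = hyp2F1_term a c e n * (e / (e + INR n)).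
Proof.
  intros He. unfold hyp2F1_term.
  pose proof (poch_neq_0 e n He) as H1. pose proof (plus_INR_neq_0 e n He) as H2.
  pose proof (poch_neq_0 (e + 1) n (not_nonpos_int_S e He)) as H3.
  pose proof (not_nonpos_int_neq_0 e He) as H4.
  pose proof (poch_shift e n) as E.
  replace (poch e n) with (e * poch (e + 1) n / (e + INR n))
    by (rewrite E; field; exact H2).
  field. repeat split; auto. apply fact_neq_0_C.
Qed.

(** Contiguity of Gauss sums.  Termwise,
    e (e - a - c) t n - (e - a) (e - c) t' n = e n t n - e (n + 1) t (n + 1)
    where t and t' have lower parameters e and e + 1. *)
Lemma gauss_step (a c e F : C) :
  ~ nonpos_int e -> e - a <> 0 -> e - c <> 0 ->
  Csum (hyp2F1_term a c e) F -> Clim (fun n => INR n * hyp2F1_term a c e n) 0 ->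
  exists F', Csum (hyp2F1_term a c (e + 1)) F' /\
    Clim (fun n => INR n * hyp2F1_term a c (e + 1) n) 0 /\
    e * (e - a - c) * F = (e - a) * (e - c) * F'.
Proof.
  intros He Ha Hc HF H0.
  exists (e * (e - a - c) / ((e - a) * (e - c)) * F).
  split; [|split].
  - replace (e * (e - a - c) / ((e - a) * (e - c)) * F)
      with (e * (e - a - c) / ((e - a) * (e - c)) * F
            + e / ((e - a) * (e - c)) * (0 - INR 0 * hyp2F1_term a c e 0))
      by (simpl; field; auto).
    eapply Csum_ext; [|apply Csum_plus; apply Csum_scal;
                        [exact HF|exact (Csum_telescope _ _ H0)]].
    intros n. cbv beta. rewrite hyp2F1_term_S, hyp2F1_term_e_S, RtoC_S by exact He.
    pose proof (plus_INR_neq_0 e n He). pose proof (RtoC_S_neq_0 n) as H3.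
    rewrite RtoC_S in H3. field. repeat split; auto.
  - replace (RtoC 0) with (0 * (e * 0)) by ring.
    eapply Clim_ext; [|exact (Clim_mult _ _ _ _ H0 (Clim_scal e _ _ (Clim_shift_inv e He)))].
    intros n. cbv beta. rewrite hyp2F1_term_e_S by exact He. unfold Cdiv. ring.
  - field. auto.
Qed.

Lemma gauss_iterate (a c e F : C) (N : nat) :
  ~ nonpos_int e -> ~ nonpos_int (e - a) -> ~ nonpos_int (e - c) ->
  Csum (hyp2F1_term a c e) F -> Clim (fun n => INR n * hyp2F1_term a c e n) 0 ->
  exists F', Csum (hyp2F1_term a c (e + INR N)) F' /\
    Clim (fun n => INR n * hyp2F1_term a c (e + INR N) n) 0 /\
    poch e N * poch (e - a - c) N * F = poch (e - a) N * poch (e - c) N * F'.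
Proof.
  intros He Ha Hc HF H0. induction N as [|N [F' [IH1 [IH2 IH3]]]].
  - exists F. simpl. rewrite Cplus_0_r. auto.
  - destruct (gauss_step a c (e + INR N) F') as [F'' [G1 [G2 G3]]]; auto.
    + now apply not_nonpos_int_shift.
    + replace (e + INR N - a) with (e - a + INR N) by ring. now apply plus_INR_neq_0.
    + replace (e + INR N - c) with (e - c + INR N) by ring. now apply plus_INR_neq_0.
    + exists F''. rewrite RtoC_S, Cplus_assoc. split; [exact G1|split; [exact G2|]].
      simpl poch.
      transitivity (poch e N * poch (e - a - c) N * F * (e + INR N) * (e - a - c + INR N));
        [ring|].
      rewrite IH3.
      transitivity (poch (e - a) N * poch (e - c) N *
                    ((e + INR N) * (e + INR N - a - c) * F')); [ring|].
      rewrite G3. ring.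
Qed.

(** For M large the ratio of the terms n + 2 and n + 1 is at most
    (n + 1) / (n + 3), which makes the terms summable with a sum of order 1 / M. *)
Lemma hyp2F1_term_large_e (a c e : C) (M : R) :
  ~ nonpos_int e ->
  (forall n, (M + INR n <= Cmod (e + INR n))%R) ->
  (1 + 3 * (Cmod a + Cmod c + Cmod a * Cmod c) <= M)%R ->
  forall n, (Cmod (hyp2F1_term a c e (S n))
             <= 2 * (Cmod a * Cmod c) / M * / ((INR n + 1) * (INR n + 2)))%R.
Proof.
  intros He Hlow HM.
  pose proof (Cmod_ge_0 a) as HA. pose proof (Cmod_ge_0 c) as HC.
  set (A := Cmod a) in *. set (B := Cmod c) in *.
  assert (HAB : (0 <= A * B)%R) by nra.
  assert (Hratio : forall n,
    (Cmod ((a + INR n) * (c + INR n) / ((e + INR n) * (INR n + 1)))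
     <= (A + INR n) * (B + INR n) / ((M + INR n) * (INR n + 1)))%R).
  { intros n. pose proof (pos_INR n) as Hn. pose proof (plus_INR_neq_0 e n He) as Hne.
    rewrite Cmod_div, !Cmod_mult.
    2:{ apply Cmult_neq_0; [exact Hne|]. rewrite <- RtoC_S. apply RtoC_S_neq_0. }
    rewrite <- RtoC_plus, Cmod_R, (Rabs_pos_eq (INR n + 1)) by lra.
    assert (T : forall x, (Cmod (x + INR n) <= Cmod x + INR n)%R).
    { intros x. eapply Rle_trans; [apply Cmod_triangle|].
      rewrite Cmod_R, Rabs_pos_eq by exact Hn. lra. }
    specialize (Hlow n).
    unfold Rdiv. apply Rmult_le_compat.
    - apply Rmult_le_pos; apply Cmod_ge_0.
    - left. apply Rinv_0_lt_compat. apply Rmult_lt_0_compat; lra.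
    - apply Rmult_le_compat; try apply Cmod_ge_0; apply T.
    - apply Rinv_le_contravar; [apply Rmult_lt_0_compat; lra|].
      apply Rmult_le_compat_r; lra. }
  induction n.
  - rewrite hyp2F1_term_S, hyp2F1_term_O, Cmult_1_l by exact He.
    eapply Rle_trans; [apply Hratio|]. simpl. right. field. lra.
  - rewrite hyp2F1_term_S, Cmod_mult by exact He.
    pose proof (pos_INR n) as Hn. specialize (Hratio (S n)). rewrite (S_INR n) in *.
    set (x := INR n) in *.
    eapply Rle_trans.
    + apply Rmult_le_compat; [apply Cmod_ge_0|apply Cmod_ge_0|exact IHn|exact Hratio].
    + rewrite Rmult_assoc. apply Rmult_le_compat_l.
      { apply Rdiv_le_0_compat; lra. }
      replace (/ ((x + 1) * (x + 2)) *
               ((A + (x + 1)) * (B + (x + 1)) / ((M + (x + 1)) * (x + 1 + 1))))%R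
        with (((A + (x + 1)) * (B + (x + 1)) * (x + 3)) *
              / ((x + 1) * (x + 2) * (M + (x + 1)) * (x + 2) * (x + 3)))%R
        by (field; lra).
      replace (/ ((x + 1 + 1) * (x + 1 + 2)))%R
        with (((x + 1) * (x + 2) * (M + (x + 1))) *
              / ((x + 1) * (x + 2) * (M + (x + 1)) * (x + 2) * (x + 3)))%R
        by (field; lra).
      apply Rmult_le_compat_r.
      { left. apply Rinv_0_lt_compat. repeat apply Rmult_lt_0_compat; lra. }
      set (y := (x + 1)%R). assert (Hy : (1 <= y)%R) by (unfold y; lra).
      replace (x + 3)%R with (y + 2)%R by (unfold y; ring).
      replace (x + 2)%R with (y + 1)%R by (unfold y; ring).
      assert (E : (0 <= (M - (A + B + 1)) * y ^ 2 + (M - (A * B + 2 * A + 2 * B)) * y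
                        - 2 * (A * B))%R).
      { assert (0 <= (M - (A + B + 1)) * y ^ 2)%R.
        { apply Rmult_le_pos; [lra|apply pow2_ge_0]. }
        assert (2 * (A * B) * 1 <= (M - (A * B + 2 * A + 2 * B)) * y)%R.
        { apply Rmult_le_compat; lra. }
        lra. }
      nra.
Qed.

Lemma hyp2F1_term_sum_tends_to_1 (a c e : C) (F : nat -> C) :
  ~ nonpos_int e ->
  (forall N, Csum (hyp2F1_term a c (e + INR N)) (F N)) -> Clim F 1.
Proof.
  intros He HF.
  set (Q := (Cmod a * Cmod c)%R).
  assert (HQ : (0 <= Q)%R) by (apply Rmult_le_pos; apply Cmod_ge_0).
  set (M0 := (1 + 3 * (Cmod a + Cmod c + Q))%R).
  assert (HM0 : (1 <= M0)%R).
  { unfold M0. pose proof (Cmod_ge_0 a). pose proof (Cmod_ge_0 c). lra. }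
  assert (HB : forall N, (M0 <= INR N - Cmod e)%R ->
            (Cmod (F N - 1) <= 4 * Q * / (INR N - Cmod e))%R).
  { intros N HN. set (M := (INR N - Cmod e)%R) in *.
    assert (He' : ~ nonpos_int (e + INR N)) by now apply not_nonpos_int_shift.
    assert (Hlow : forall n, (M + INR n <= Cmod (e + INR N + INR n))%R).
    { intros n. pose proof (Cmod_plus_ge (INR N + INR n)%R e) as G.
      rewrite Cmod_R, Rabs_pos_eq in G
        by (pose proof (pos_INR N); pose proof (pos_INR n); lra).
      replace (e + INR N + INR n) with ((INR N + INR n)%R + e)
        by (rewrite RtoC_plus; ring). unfold M. lra. }
    pose proof (hyp2F1_term_large_e a c (e + INR N) M He' Hlow HN) as Hb. fold Q in Hb.
    apply (Clim_Cmod_le (fun m => psum (hyp2F1_term a c (e + INR N)) (S m) - 1)).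
    - intros m. rewrite psum_shift, hyp2F1_term_O.
      replace (1 + psum (fun k => hyp2F1_term a c (e + INR N) (S k)) m - 1)
        with (psum (fun k => hyp2F1_term a c (e + INR N) (S k)) m
              - psum (fun k => hyp2F1_term a c (e + INR N) (S k)) 0) by (simpl; ring).
      replace (4 * Q * / M)%R with (2 * (2 * Q / M))%R by (field; lra).
      apply drift_bound.
      + apply Rdiv_le_0_compat; lra.
      + intros k. simpl psum.
        replace (psum (fun k => hyp2F1_term a c (e + INR N) (S k)) k
                 + hyp2F1_term a c (e + INR N) (S k)
                 - psum (fun k => hyp2F1_term a c (e + INR N) (S k)) k)
          with (hyp2F1_term a c (e + INR N) (S k)) by ring.
        eapply Rle_trans; [apply Hb|]. apply Rmult_le_compat_l.
        * apply Rdiv_le_0_compat; lra.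
        * rewrite S_INR. pose proof (pos_INR k).
          apply Rinv_le_contravar; [apply pow_lt; lra|nra].
    - apply Clim_minus; [|apply Clim_const]. apply (Clim_incr _ _ (HF N)). }
  apply Clim_Cmod_0.
  apply is_lim_seq_le_le_loc with (u := fun _ => 0%R)
    (w := fun N => (4 * Q * / (INR N - Cmod e))%R).
  - destruct (nfloor_ex (M0 + Cmod e)) as [N0 [_ HN0]].
    { pose proof (Cmod_ge_0 e). lra. }
    exists (S N0). intros N HN. split; [apply Cmod_ge_0|]. apply HB.
    apply le_INR in HN. rewrite S_INR in HN. lra.
  - apply is_lim_seq_const.
  - replace (Finite 0) with (Finite (4 * Q * 0)) by (f_equal; ring).
    apply is_lim_seq_mult'; [apply is_lim_seq_const|].
    apply (is_lim_seq_inv _ p_infty); [|discriminate].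
    apply (is_lim_seq_plus _ _ p_infty (Finite (- Cmod e)) p_infty).
    + apply is_lim_seq_INR.
    + apply is_lim_seq_const.
    + reflexivity.
Qed.

(** Iterating [gauss_step] moves e to infinity, where the sum tends to 1.  The
    accumulated rising factorials are Euler's approximations of the four Gamma
    values; the powers of n cancel because e + (e - a - c) = (e - a) + (e - c).
    The sequence n t n tends to 0 when Re (e - a - c) > 0, and trivially when the
    sum terminates. *)
Theorem gauss_summation (a c e F : C) :
  ~ nonpos_int e -> ~ nonpos_int (e - a) -> ~ nonpos_int (e - c) ->
  ~ nonpos_int (e - a - c) ->
  Csum (hyp2F1_term a c e) F -> Clim (fun n => INR n * hyp2F1_term a c e n) 0 ->
  F = Gamma e * Gamma (e - a - c) / (Gamma (e - a) * Gamma (e - c)).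
Proof.
  intros He Ha Hc Hac HF H0.
  set (FN := fun N => CSeries (hyp2F1_term a c (e + INR N))).
  assert (HFN : forall N, Csum (hyp2F1_term a c (e + INR N)) (FN N) /\
    poch e N * poch (e - a - c) N * F = poch (e - a) N * poch (e - c) N * FN N).
  { intros N. destruct (gauss_iterate a c e F N) as [F' [G1 [_ G3]]]; auto.
    unfold FN. rewrite (Csum_CSeries _ _ G1). auto. }
  assert (H1 : Clim FN 1)
    by (apply (hyp2F1_term_sum_tends_to_1 a c e); [exact He|intros N; apply HFN]).
  assert (E : F * (Gamma (e - a) * Gamma (e - c)) = Gamma e * Gamma (e - a - c) * 1).
  { apply (Clim_unique (fun n => F * (Gamma_seq (e - a) n * Gamma_seq (e - c) n))).
    - apply Clim_scal. apply Clim_mult; now apply Gamma_limit.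
    - apply Clim_ext with (fun n => Gamma_seq e n * Gamma_seq (e - a - c) n * FN (S n)).
      + intros n. destruct (HFN (S n)) as [_ G]. unfold Gamma_seq. rewrite !RCpower_cexp.
        set (l := RtoC (ln (INR n))).
        assert (X : cexp (e * l) * cexp ((e - a - c) * l)
                    = cexp ((e - a) * l) * cexp ((e - c) * l)).
        { rewrite <- !cexp_plus. f_equal. ring. }
        pose proof (poch_neq_0 _ (S n) He) as P1.
        pose proof (poch_neq_0 _ (S n) Ha) as P2.
        pose proof (poch_neq_0 _ (S n) Hc) as P3.
        pose proof (poch_neq_0 _ (S n) Hac) as P4.
        set (p1 := poch e (S n)) in *. set (p2 := poch (e - a) (S n)) in *.
        set (p3 := poch (e - c) (S n)) in *. set (p4 := poch (e - a - c) (S n)) in *.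
        replace F with (p2 * p3 * FN (S n) / (p1 * p4)) by (rewrite <- G; field; auto).
        transitivity (INR (fact n) * INR (fact n) * FN (S n) / (p1 * p4)
                      * (cexp (e * l) * cexp ((e - a - c) * l))); [field; auto|].
        rewrite X. field. auto.
      + apply Clim_mult; [|apply (Clim_incr _ _ H1)].
        apply Clim_mult; now apply Gamma_limit. }
  rewrite Cmult_1_r in E. rewrite <- E. field.
  split; now apply Gamma_neq_0.
Qed.

(** * Summation by parts *)

(** Otherwise Re (v n / Y) >= 1 / (2 n) for large n, and the series dominates a
    divergent harmonic series. *)
Lemma Csum_harmonic_order (v : nat -> C) (L Y : C) :
  Csum v L -> Clim (fun n => INR n * v n) Y -> Y = 0.
Proof.
  intros HL HY. destruct (Ceq_dec Y 0) as [E|Hne]; [exact E|exfalso].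
  assert (HL' : Csum (fun n => / Y * v n) (/ Y * L)) by now apply Csum_scal.
  assert (HY' : Clim (fun n => / Y * (INR n * v n)) 1).
  { replace (RtoC 1) with (/ Y * Y) by (field; exact Hne). now apply Clim_scal. }
  destruct HY' as [HR _]. apply is_lim_seq_spec in HR.
  assert (Hhalf : (0 < / 2)%R) by lra.
  destruct (HR (mkposreal _ Hhalf)) as [N HN]. clear HR.
  set (w := fun n => / Y * v n) in *.
  assert (Hw : forall n, (S N <= n)%nat -> (/ 2 * / INR n <= Re (w n))%R).
  { intros n Hn. specialize (HN n ltac:(lia)). simpl pos in HN. simpl (Re 1) in HN.
    replace (/ Y * (INR n * v n)) with (INR n * w n) in HN by (unfold w; ring).
    rewrite re_scal_l in HN. apply Rabs_lt_between in HN.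
    assert (Hp : (0 < INR n)%R) by (apply lt_0_INR; lia).
    apply (Rmult_le_reg_l (INR n)); [exact Hp|].
    replace (INR n * (/ 2 * / INR n))%R with (/ 2)%R by (field; lra). lra. }
  assert (Hge : forall n, (S N <= n)%nat ->
    (Re (psum w (S N)) - / 2 * ln (INR (S N)) + / 2 * ln (INR n) <= Re (psum w n))%R).
  { intros n Hn. induction Hn as [|n Hn IH]; [lra|].
    change (Re (psum w (S n))) with (Re (psum w n) + Re (w n))%R.
    specialize (Hw n Hn).
    assert (Hp : (0 < INR n)%R) by (apply lt_0_INR; lia).
    pose proof (ln_le_sub (INR (S n) / INR n)) as L1.
    rewrite ln_div in L1 by (try apply INR_S_pos; exact Hp).
    assert (P : (0 < INR (S n) / INR n)%R)
      by (apply Rdiv_lt_0_compat; [apply INR_S_pos|exact Hp]).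
    specialize (L1 P).
    replace (INR (S n) / INR n - 1)%R with (/ INR n)%R in L1
      by (rewrite S_INR; field; lra).
    lra. }
  destruct HL' as [HR _].
  assert (HP : is_lim_seq (fun n => Re (psum w n)) p_infty).
  { apply is_lim_seq_le_p_loc with
      (u := fun n => (Re (psum w (S N)) - / 2 * ln (INR (S N)) + / 2 * ln (INR n))%R).
    - exists (S N). exact Hge.
    - eapply is_lim_seq_plus; [apply is_lim_seq_const| |].
      + apply (is_lim_seq_scal_l _ (/ 2) p_infty).
        apply (filterlim_comp _ _ _ INR ln _ (Rbar_locally p_infty)).
        * apply is_lim_seq_INR.
        * apply is_lim_ln_p.
      + unfold Rbar_mult, Rbar_mult'. destruct (Rle_dec 0 (/ 2)) as [H|H]; [|lra].
        destruct (Rle_lt_or_eq_dec 0 (/ 2) H) as [H'|H']; [reflexivity|lra]. }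
  apply is_lim_seq_unique in HR. apply is_lim_seq_unique in HP.
  rewrite HP in HR. discriminate.
Qed.

(** The boundary term u of the summation by parts.  Its increments are
    t n (a c + (1 + a + c - e) n), the combination of t n and n t n in which
    the two logarithmic series occur. *)
Definition boundary (a c e : C) (n : nat) : C :=
  INR n * (INR n + e - 1) * hyp2F1_term a c e n.

Lemma boundary_S (a c e : C) (n : nat) :
  ~ nonpos_int e ->
  boundary a c e (S n) = (INR n + a) * (INR n + c) * hyp2F1_term a c e n.
Proof.
  intros He. unfold boundary. rewrite hyp2F1_term_S, RtoC_S by exact He.
  pose proof (plus_INR_neq_0 e n He). pose proof (RtoC_S_neq_0 n) as H3.
  rewrite RtoC_S in H3. field. auto.
Qed.

Lemma boundary_diff (a c e : C) (n : nat) :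
  ~ nonpos_int e ->
  boundary a c e (S n) - boundary a c e n
  = a * c * hyp2F1_term a c e n + (1 + a + c - e) * (INR n * hyp2F1_term a c e n).
Proof. intros He. rewrite boundary_S by exact He. unfold boundary. ring. Qed.

Lemma boundary_harmonic_diff (a b c e x : C) (n : nat) :
  ~ nonpos_int b -> ~ nonpos_int e ->
  boundary a c e (S n) * (harmonic b (S n) - x) - boundary a c e n * (harmonic b n - x)
  = (a * c * hyp2F1_term a c e n + (1 + a + c - e) * (INR n * hyp2F1_term a c e n))
      * (harmonic b n - x)
    + INR n * hyp2F1_term a c e n + (a + c - b) * hyp2F1_term a c e n
    + (a - b) * (c - b) * (hyp2F1_term a c e n / (b + INR n)).
Proof.
  intros Hb He. rewrite <- boundary_diff by exact He.
  transitivity ((boundary a c e (S n) - boundary a c e n) * (harmonic b n - x)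
                + boundary a c e (S n) / (b + INR n)).
  - change (harmonic b (S n)) with (harmonic b n + / (b + INR n)). unfold Cdiv. ring.
  - rewrite (boundary_S a c e n He). field. now apply plus_INR_neq_0.
Qed.

(** Convergence of the three series alone forces all the decay that is needed;
    the size of t n as a power of n is never computed.
    Write s = 1 + a + c - e, H n for the harmonic number, and
    v n = n t n (H n - 1/b).  As v n tends to 0 and |H n| to infinity, n t n
    tends to 0, so the series of t n / (b + n) converges absolutely and that of
    t n converges.  The increments of y n = u n (H n - 1/b - 1/s) are then a
    combination of convergent series: the shift 1/s cancels the sum of n t n,
    which is not yet known to converge.  Hence y converges, u tends to 0, and
    u n (H n - 1/b) has a limit Y.  Finally n v n tends to Y as well, and the
    convergence of the series of v forces Y = 0. *)
Lemma boundary_limits (a b c e f L0 L1 L2 : C) :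
  ~ nonpos_int b -> ~ nonpos_int e ->
  1 + a + c - e <> 0 ->
  Csum (fun n => hyp2F1_term a c e n * (f + INR n) / (b + INR n)) L0 ->
  Csum (fun n => hyp2F1_term a c e n * harmonic b n) L1 ->
  Csum (fun n => INR n * hyp2F1_term a c e n * (harmonic b n - / b)) L2 ->
  exists F S,
    Csum (hyp2F1_term a c e) F /\ Csum (fun n => hyp2F1_term a c e n / (b + INR n)) S /\
    Clim (boundary a c e) 0 /\ Clim (fun n => boundary a c e n * harmonic b n) 0.
Proof.
  intros Hb He Hs H0 H1 H2.
  set (t := hyp2F1_term a c e) in *. set (u := boundary a c e).
  set (s := 1 + a + c - e) in *.
  set (g := fun n => harmonic b n - / b).
  set (v := fun n => INR n * t n * g n).
  assert (Hv0 : Clim v 0) by exact (Csum_term_0 _ _ H2).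
  assert (Hb0 : b <> 0) by now apply not_nonpos_int_neq_0.
  assert (Hnt : Clim (fun n => INR n * t n) 0).
  { apply Clim_squeeze_0 with (m := fun n => Cmod (v n)).
    - pose proof (harmonic_diverges b (/ b) Hb) as Hg.
      apply is_lim_seq_spec in Hg. destruct (Hg 1%R) as [N HN].
      exists N. intros n Hn. specialize (HN n Hn). unfold v, g.
      rewrite (Cmod_mult (INR n * t n)).
      pose proof (Cmod_ge_0 (INR n * t n)). nra.
    - rewrite <- Cmod_0. now apply Clim_Cmod. }
  assert (HS : exists S, Csum (fun n => t n / (b + INR n)) S).
  { destruct (Clim_bounded _ _ Hnt) as [K HK].
    destruct (shift_inv_bound b Hb) as [B [HB Hinv]].
    destruct (Csum_inv_sq (fun n => t (S n) / (b + INR (S n))) (K * B)) as [S' HS'].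
    - intros n. specialize (HK (S n)). specialize (Hinv (S n)).
      pose proof (INR_S_pos n) as Hp. pose proof (inv_INR_S_le_1 n) as Hx.
      rewrite Cmod_mult, Cmod_R, Rabs_pos_eq in HK by lra.
      unfold Cdiv. rewrite Cmod_mult.
      assert (K1 : (Cmod (t (S n)) <= K * / INR (S n))%R).
      { apply (Rmult_le_reg_l (INR (S n))); [exact Hp|].
        replace (INR (S n) * (K * / INR (S n)))%R with K by (field; lra). exact HK. }
      assert (K2 : (Cmod (/ (b + INR (S n))) <= B * / INR (S n))%R).
      { eapply Rle_trans; [exact Hinv|]. apply Rmult_le_compat_l; [exact HB|].
        apply Rinv_le_contravar; [exact Hp|]. rewrite (S_INR (S n)). lra. }
      replace (K * B * / INR (S n) ^ 2)%R with ((K * / INR (S n)) * (B * / INR (S n)))%R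
        by (field; lra).
      apply Rmult_le_compat; auto; apply Cmod_ge_0.
    - eexists. exact (Csum_shift _ _ HS'). }
  destruct HS as [S HS].
  assert (HF : Csum t (L0 + (b - f) * S)).
  { eapply Csum_ext; [|exact (Csum_plus _ _ _ _ H0 (Csum_scal (b - f) _ _ HS))].
    intros n. cbv beta. field. now apply plus_INR_neq_0. }
  set (F := L0 + (b - f) * S) in *.
  exists F, S. split; [exact HF|]. split; [exact HS|].
  (* With this shift the terms in n t n cancel from the increments of y. *)
  set (x := / b + / s).
  set (y := fun n => u n * (harmonic b n - x)).
  assert (Hy : exists Y, Clim y Y).
  { eexists. apply (Csum_telescope_inv y).
    eapply Csum_ext.
    2:{ exact (Csum_plus _ _ _ _ (Csum_scal s _ _ H2)
          (Csum_plus _ _ _ _ (Csum_scal (a * c) _ _ H1)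
          (Csum_plus _ _ _ _ (Csum_scal (a + c - b - a * c * x) _ _ HF)
             (Csum_scal ((a - b) * (c - b)) _ _ HS)))). }
    intros n. unfold y, u. rewrite boundary_harmonic_diff by assumption.
    fold t s. unfold x.
    cbv beta. field. split; [now apply plus_INR_neq_0|]. split; assumption. }
  destruct Hy as [Y HY].
  assert (Hu : Clim u 0).
  { destruct (Clim_bounded _ _ HY) as [K HK].
    pose proof (harmonic_diverges b x Hb) as Hg.
    apply Clim_squeeze_0 with (m := fun n => (K * / Cmod (harmonic b n - x))%R).
    - apply is_lim_seq_spec in Hg. destruct (Hg 0%R) as [N HN].
      exists N. intros n Hn. specialize (HN n Hn). specialize (HK n). unfold y in HK.
      rewrite Cmod_mult in HK.
      apply (Rmult_le_reg_r (Cmod (harmonic b n - x))); [exact HN|].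
      rewrite Rmult_assoc, Rinv_l, Rmult_1_r by lra. exact HK.
    - replace (Finite 0) with (Finite (K * 0)) by (f_equal; ring).
      apply is_lim_seq_mult'; [apply is_lim_seq_const|].
      apply (is_lim_seq_inv _ p_infty); [exact Hg|discriminate]. }
  split; [exact Hu|].
  assert (HuH : forall z, Clim (fun n => u n * (harmonic b n - z)) Y).
  { intros z. replace Y with (Y + (x - z) * 0) by ring.
    eapply Clim_ext; [|exact (Clim_plus _ _ _ _ HY (Clim_scal (x - z) _ _ Hu))].
    intros n. unfold y. ring. }
  assert (HY0 : Y = 0).
  { apply (Csum_harmonic_order v L2); [exact H2|].
    replace Y with (Y - (e - 1) * 0) by ring.
    eapply Clim_ext; [|exact (Clim_minus _ _ _ _ (HuH (/ b)) (Clim_scal (e - 1) _ _ Hv0))].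
    intros n. unfold u, boundary, v, g. fold t. ring. }
  rewrite HY0 in HuH.
  eapply Clim_ext; [|exact (HuH 0)]. intros n. cbv beta. ring.
Qed.

(** The telescoping sums of u n and of u n H n both vanish.  The first gives
    the sum of n t n in terms of F; in the second the factor
    (n + a) (n + c) / (b + n) is expanded as
    n + (a + c - b) + (a - b) (c - b) / (b + n). *)
Lemma harmonic_sum_relation (a b c e L1 L2 F S : C) :
  ~ nonpos_int b -> ~ nonpos_int e ->
  1 + a + c - e <> 0 -> b <> 0 ->
  Csum (fun n => hyp2F1_term a c e n * harmonic b n) L1 ->
  Csum (fun n => INR n * hyp2F1_term a c e n * (harmonic b n - / b)) L2 ->
  Csum (hyp2F1_term a c e) F -> Csum (fun n => hyp2F1_term a c e n / (b + INR n)) S ->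
  Clim (boundary a c e) 0 -> Clim (fun n => boundary a c e n * harmonic b n) 0 ->
  (b - a) * (b - c) * S
  = a * c * F / b + a * c * F / (1 + a + c - e) - (a + c - b) * F
    - (a * c * L1 + (1 + a + c - e) * L2).
Proof.
  intros Hb He Hs Hb0 H1 H2 HF HS Hu HuH. set (s := 1 + a + c - e) in *.
  set (t := hyp2F1_term a c e) in *. set (u := boundary a c e) in *.
  assert (HN : Csum (fun n => INR n * t n) (- (a * c / s) * F)).
  { replace (- (a * c / s) * F) with (/ s * (0 - u O) + (- (a * c / s)) * F)
      by (unfold u, boundary; simpl; ring).
    eapply Csum_ext; [|apply Csum_plus;
      [exact (Csum_scal (/ s) _ _ (Csum_telescope _ _ Hu))|exact (Csum_scal _ _ _ HF)]].
    intros n. cbv beta. unfold u. rewrite boundary_diff by exact He. fold t s. field. exact Hs. }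
  assert (E : a * c * L1 + s * L2 + ((s / b + 1) * (- (a * c / s) * F)
              + ((a + c - b) * F + (a - b) * (c - b) * S)) = 0).
  { apply (Clim_unique (psum (fun n => u (Datatypes.S n) * harmonic b (Datatypes.S n)
                                       - u n * harmonic b n))).
    - eapply Csum_ext; [|exact (Csum_plus _ _ _ _
         (Csum_plus _ _ _ _ (Csum_scal (a * c) _ _ H1) (Csum_scal s _ _ H2))
         (Csum_plus _ _ _ _ (Csum_scal (s / b + 1) _ _ HN)
         (Csum_plus _ _ _ _ (Csum_scal (a + c - b) _ _ HF)
            (Csum_scal ((a - b) * (c - b)) _ _ HS))))].
      intros n. cbv beta. pose proof (boundary_harmonic_diff a b c e 0 n Hb He) as D.
      fold t u s in D.
      replace (harmonic b (Datatypes.S n) - 0) with (harmonic b (Datatypes.S n)) in D by ring.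
      replace (harmonic b n - 0) with (harmonic b n) in D by ring.
      rewrite D. field. split; [now apply plus_INR_neq_0|exact Hb0].
    - replace (RtoC 0) with (0 - u O * harmonic b O) by (unfold u, boundary; simpl; ring).
      exact (Csum_telescope _ _ HuH). }
  transitivity ((b - a) * (b - c) * S
    - (a * c * L1 + s * L2 + ((s / b + 1) * (- (a * c / s) * F)
              + ((a + c - b) * F + (a - b) * (c - b) * S)))).
  - rewrite E. ring.
  - field. auto.
Qed.

(** * The hypergeometric and logarithmic series *)

(** Two pairs of parameters differ by 1, so four rising factorials collapse to a
    rational function of n. *)
Lemma hyp4F3_term_hyp2F1_term (a b c e f : C) (n : nat) :
  ~ nonpos_int b -> ~ nonpos_int e -> ~ nonpos_int f ->
  hyp4F3_term a b c (f + 1) (b + 1) e f n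
  = b / f * (hyp2F1_term a c e n * (f + INR n) / (b + INR n)).
Proof.
  intros Hb He Hf. unfold hyp4F3_term, hyp2F1_term.
  pose proof (not_nonpos_int_neq_0 b Hb) as B0. pose proof (not_nonpos_int_neq_0 f Hf) as F0.
  pose proof (poch_neq_0 b n Hb) as P1. pose proof (poch_neq_0 e n He) as P2.
  pose proof (poch_neq_0 f n Hf) as P3. pose proof (fact_neq_0_C n) as P4.
  pose proof (plus_INR_neq_0 b n Hb) as P5.
  replace (poch (f + 1) n) with (poch f n * (f + INR n) / f)
    by (rewrite <- poch_shift; field; exact F0).
  replace (poch (b + 1) n) with (poch b n * (b + INR n) / b)
    by (rewrite <- poch_shift; field; exact B0).
  field. repeat split; auto.
Qed.

Lemma hat2F1_Csum (a c e b : C) :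
  ~ nonpos_int b -> Cex_series (hat2F1_summand a c e b) ->
  Csum (fun n => hyp2F1_term a c e n * harmonic b n) (hat2F1 a c e b).
Proof.
  intros Hb H. apply Cex_series_Csum in H. fold (hat2F1 a c e b) in H.
  replace (hat2F1 a c e b) with (hyp2F1_term a c e 0 * harmonic b O + hat2F1 a c e b)
    by (unfold harmonic; simpl; ring).
  apply (Csum_shift (fun n => hyp2F1_term a c e n * harmonic b n)).
  eapply Csum_ext; [|exact H]. intros n.
  unfold hat2F1_summand, hat2F1_term. rewrite digamma_plus_INR by exact Hb. reflexivity.
Qed.

Lemma hyp2F1_term_shift_params (a c e : C) (n : nat) :
  ~ nonpos_int e ->
  a * c / e * hyp2F1_term (a + 1) (c + 1) (e + 1) n = INR (S n) * hyp2F1_term a c e (S n).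
Proof.
  intros He. unfold hyp2F1_term.
  change (fact (S n)) with (S n * fact n)%nat. rewrite mult_INR, RtoC_mult.
  simpl poch. rewrite <- !poch_shift.
  pose proof (poch_neq_0 _ n (not_nonpos_int_S e He)) as P1.
  pose proof (not_nonpos_int_neq_0 e He) as E0.
  pose proof (fact_neq_0_C n). pose proof (RtoC_S_neq_0 n).
  field. auto.
Qed.

(** Raising all parameters by 1 shifts the index: with this normalisation the
    second logarithmic series runs over the same terms t n as the first. *)
Lemma hat2F1_shift_Csum (a c e b : C) :
  ~ nonpos_int b -> ~ nonpos_int e ->
  Cex_series (hat2F1_summand (a + 1) (c + 1) (e + 1) (b + 1)) ->
  Csum (fun n => INR n * hyp2F1_term a c e n * (harmonic b n - / b))
       (a * c / e * hat2F1 (a + 1) (c + 1) (e + 1) (b + 1)).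
Proof.
  intros Hb He H.
  pose proof (hat2F1_Csum _ _ _ _ (not_nonpos_int_S b Hb) H) as H'.
  apply (Csum_scal (a * c / e)) in H'.
  set (L := a * c / e * hat2F1 (a + 1) (c + 1) (e + 1) (b + 1)) in *.
  replace L with ((fun n => INR n * hyp2F1_term a c e n * (harmonic b n - / b)) O + L)
    by (simpl; ring).
  apply Csum_shift. eapply Csum_ext; [|exact H'].
  intros n. cbv beta. rewrite Cmult_assoc, hyp2F1_term_shift_params by exact He.
  f_equal. unfold harmonic. rewrite psum_shift. change (RtoC (INR 0)) with (RtoC 0).
  rewrite Cplus_0_r.
  rewrite (psum_ext (fun j => / (b + 1 + INR j)) (fun k => / (b + INR (S k)))).
  - ring.
  - intros k. rewrite RtoC_S. f_equal. ring.
Qed.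

Theorem theorem4 :
  forall a b c e f : C,
    (* no lower parameter, and no argument of Gamma or psi, is a pole *)
    ~ nonpos_int b -> ~ nonpos_int (b + 1) ->
    ~ nonpos_int e -> ~ nonpos_int (e + 1) ->
    ~ nonpos_int f ->
    ~ nonpos_int (e - a - c - 1) ->
    ~ nonpos_int (e - a) -> ~ nonpos_int (e - c) ->
    (* nonzero denominators *)
    f * (b - a) * (b - c) <> 0 ->
    (* all infinite series converge *)
    Cex_series (hyp4F3_term a b c (f + 1) (b + 1) e f) ->
    Cex_series (hat2F1_summand a c e b) ->
    Cex_series (hat2F1_summand (a + 1) (c + 1) (e + 1) (b + 1)) ->
    hyp4F3 a b c (f + 1) (b + 1) e f =
      a * b * c * (b - f) / (f * (b - a) * (b - c))
        * (hat2F1 a c e b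
           + (1 + a + c - e) / e * hat2F1 (a + 1) (c + 1) (e + 1) (b + 1))
      + (f * (b - c) * (a ^ 2 + (a - b) * (c - e + 1)) + a * b ^ 2 * (c - f))
          / (f * (b - a) * (b - c))
        * (Gamma e * Gamma (e - a - c - 1) / (Gamma (e - a) * Gamma (e - c))).
Proof.
  intros a b c e f Hb _ He _ Hf Hs Ha Hc Hden H4 H1 H2.
  assert (Hf0 : f <> 0) by now apply not_nonpos_int_neq_0.
  assert (Hb0 : b <> 0) by now apply not_nonpos_int_neq_0.
  assert (He0 : e <> 0) by now apply not_nonpos_int_neq_0.
  assert (Hba : b - a <> 0) by (intros E; apply Hden; rewrite E; ring).
  assert (Hbc : b - c <> 0) by (intros E; apply Hden; rewrite E; ring).
  assert (Hs0 : 1 + a + c - e <> 0).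
  { intros E. apply (not_nonpos_int_neq_0 _ Hs).
    replace (e - a - c - 1) with (- (1 + a + c - e)) by ring. rewrite E. ring. }
  pose proof (hat2F1_Csum a c e b Hb H1) as S1.
  pose proof (hat2F1_shift_Csum a c e b Hb He H2) as S2.
  apply Cex_series_Csum in H4. fold (hyp4F3 a b c (f + 1) (b + 1) e f) in H4.
  assert (S0 : Csum (fun n => hyp2F1_term a c e n * (f + INR n) / (b + INR n))
                    (f / b * hyp4F3 a b c (f + 1) (b + 1) e f)).
  { eapply Csum_ext; [|exact (Csum_scal (f / b) _ _ H4)]. intros n. cbv beta.
    rewrite hyp4F3_term_hyp2F1_term by assumption.
    pose proof (plus_INR_neq_0 b n Hb). field. auto. }
  destruct (boundary_limits a b c e f _ _ _ Hb He Hs0 S0 S1 S2)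
    as [F [S [HF [HS [Hu HuH]]]]].
  pose proof (harmonic_sum_relation a b c e _ _ F S Hb He Hs0 Hb0 S1 S2 HF HS Hu HuH)
    as Hrel.
  assert (Hlhs : f / b * hyp4F3 a b c (f + 1) (b + 1) e f = F + (f - b) * S).
  { apply (Clim_unique _ _ _ S0).
    eapply Csum_ext; [|exact (Csum_plus _ _ _ _ HF (Csum_scal (f - b) _ _ HS))].
    intros n. cbv beta. field. now apply plus_INR_neq_0. }
  assert (Hnt : Clim (fun n => INR n * hyp2F1_term a c e n) 0).
  { apply Clim_decr.
    replace (RtoC 0) with (0 * 0) by ring.
    eapply Clim_ext; [|exact (Clim_mult _ _ _ _ (Clim_incr _ _ Hu) (Clim_shift_inv e He))].
    intros n. unfold boundary. rewrite RtoC_S.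
    pose proof (plus_INR_neq_0 e n He). field. auto. }
  assert (Hs' : ~ nonpos_int (e - a - c)).
  { replace (e - a - c) with (e - a - c - 1 + 1) by ring. now apply not_nonpos_int_S. }
  pose proof (gauss_summation a c e F He Ha Hc Hs' HF Hnt) as HG.
  replace (Gamma (e - a - c)) with ((e - a - c - 1) * Gamma (e - a - c - 1)) in HG.
  2:{ rewrite <- Gamma_S by exact Hs. f_equal. ring. }
  set (G := Gamma e * Gamma (e - a - c - 1) / (Gamma (e - a) * Gamma (e - c))).
  assert (HFG : F = (e - a - c - 1) * G) by (rewrite HG; unfold G, Cdiv; ring).
  set (L1 := hat2F1 a c e b) in *.
  set (L2 := hat2F1 (a + 1) (c + 1) (e + 1) (b + 1)) in *.
  transitivity (b / f * (f / b * hyp4F3 a b c (f + 1) (b + 1) e f));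
    [field; auto|].
  rewrite Hlhs.
  replace S with ((b - a) * (b - c) * S / ((b - a) * (b - c))) by (field; auto).
  rewrite Hrel, HFG. field. repeat split; auto.
Qed.
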